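(* Suppose $\mu$ is a regular cardinal. For all $\xi<\mu^+$ there is a club $C_\xi\subseteq\mu$ such that for all regular $\alpha\in C_\xi$ we have that $\alpha$ is not isolated in the $\tau_\xi$ topology on $\mu$ if and only if $\alpha$ is $f^\mu_\xi(\alpha)$-s-reflecting.
   Context: Canonical functions. For every regular cardinal $\kappa$ and every ordinal $\xi$ with $\kappa\le\xi<\kappa^+$ fix a bijection $b_{\kappa,\xi}:\kappa\to\xi$, with $b_{\kappa,\kappa}=\mathrm{id}_\kappa$. For $\xi<\kappa^+$ and $\alpha<\kappa$ let $F^\kappa_\xi(\alpha)=\xi$ if $\xi<\kappa$, and $F^\kappa_\xi(\alpha)=b_{\kappa,\xi}[\alpha]$ if $\kappa\le\xi<\kappa^+$. Let $f^\kappa_\xi(\alpha)=\mathrm{ot}(F^\kappa_\xi(\alpha))$. Topologies $\tau_\xi$ and operators $d_\xi:P(\mu)\to P(\mu)$ for $\xi<\mu^+$. Let $\mathcal B_0$ consist of $\{0\}$ and all open intervals $(\alpha,\beta)$ with $\alpha<\beta\le\mu$; $\tau_0$ is the topology on $\mu$ generated by $\mathcal B_0$ and $d_0$ is its limit point operator. For $\xi<\mu$: $\mathcal B_{\xi+1}=\mathcal B_\xi\cup\{d_\xi(A):A\subseteq\mu\}$; for limit $\xi<\mu$, $\mathcal B_\xi=\bigcup_{\zeta<\xi}\mathcal B_\zeta$; in each case $\tau_\xi$ is the topology on $\mu$ generated by $\mathcal B_\xi$ (as a subbasis) and $d_\xi(A)$ is the set of limit points of $A$ in $(\mu,\tau_\xi)$.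 For $\mu\le\xi<\mu^+$ and $\alpha<\mu$ let $\mathcal T_\xi(\alpha)$ be the topology on $\mu$ generated by $\mathcal B_\xi(\alpha)=\mathcal B_0\cup\{d_\zeta(A):\zeta\in F^\mu_\xi(\alpha),\ A\subseteq\mu\}$, let $d_\xi(A)=\{\alpha<\mu:\alpha\text{ is a limit point of }A\text{ in the }\mathcal T_\xi(\alpha)\text{ topology}\}$, and let $\tau_\xi=\{U\subseteq\mu:d_\xi(\mu\setminus U)\subseteq\mu\setminus U\}$, which is a topology on $\mu$. $\xi$-s-stationarity (in nonzero limit ordinals $\alpha$; no set is $\xi$-s-stationary in a non-limit ordinal). $A$ is $0$-s-stationary in $\alpha$ iff $A\cap\alpha$ is unbounded in $\alpha$. For $\alpha$ regular and $0<\xi<\alpha^+$, $A$ is $\xi$-s-stationary in $\alpha$ iff for every $\zeta<\xi$ and every pair $S,T$ of sets that are $\zeta$-s-stationary in $\alpha$ there is $\beta\in A\cap\alpha$ such that $S$ and $T$ are both $f^\alpha_\zeta(\beta)$-s-stationary in $\beta$. For $\alpha$ a limit ordinal that is not a regular cardinal and $0<\xi<\alpha$ the same definition is used with $\zeta$ in place of $f^\alpha_\zeta(\beta)$ (this is Bagaria's definition). In all remaining cases no set is $\xi$-s-stationary in $\alpha$. An ordinal $\alpha$ is $\xi$-s-reflecting if $\alpha$ is $\xi$-s-stationary in $\alpha$. *)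

(* Defs.v *)
From HB Require Import structures.
From mathcomp Require Export all_boot all_order all_classical.
From mathcomp Require Export topology_structure.

Set Implicit Arguments.
Unset Strict Implicit.
Unset Printing Implicit Defensive.

Import Order.TTheory.

Local Open Scope classical_set_scope.
Local Open Scope order_scope.

(* Ordinals are the elements of an arbitrary well-ordered type [O]: the ordinal
   [x] is identified with its initial segment [seg x], and [O] itself may have
   any order type.  Every notion below that concerns the ordinals up to [x]
   depends only on the initial segment up to [x], so it does not change when
   [O] is replaced by an end extension. *)

Section Ordinals.
Context {d : Order.disp_t} {O : orderType d}.
Implicit Types (k x z a b : O) (A C X : set O).

Definition seg x : set O := [set y | y < x].

Definition is_zero x := forall y, x <= y.

Definition is_succ z x := z < x /\ forall y, z < y -> x <= y.

Definition is_limit x :=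
  (exists y, y < x) /\ forall y, y < x -> exists z, y < z < x.

(* Infinite with cofinality [k] equal to [k]; this forces [k] to be a
   cardinal. *)
Definition regular k := is_limit k /\
  forall e, e < k -> forall g : O -> O, (forall y, y < e -> g y < k) ->
    exists2 s, s < k & forall y, y < e -> g y <= s.

(* [x < k^+] for an infinite cardinal [k]; the ordinal [k^+] itself need not
   be an element of [O]. *)
Definition lt_card_succ x k : Prop := (seg x #<= seg k)%card.

Definition unbounded_in A a :=
  forall y, y < a -> exists2 z, A z & y <= z < a.

Definition club C a := [/\ C `<=` seg a, unbounded_in C a &
  forall x, x < a -> is_limit x -> unbounded_in C x -> C x].

Definition has_order_type X x := exists h : O -> O,
  set_bij (seg x) X h /\ forall y z, y < x -> z < x -> y < z -> h y < h z.

(* The family of the bijections [bij k x : k -> x], [k <= x < k^+]; values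
   outside the relevant segments are irrelevant. *)
Definition fixed_bijections (bij : O -> O -> O -> O) :=
  (forall k x, regular k -> k <= x -> lt_card_succ x k ->
     set_bij (seg k) (seg x) (bij k x)) /\
  (forall k y, regular k -> y < k -> bij k k y = y).

Variable bij : O -> O -> O -> O.

Definition canF k x a : set O := if x < k then seg x else bij k x @` seg a.

(* [canF k x a] is a subset of [x], so it has an order type in [O] and the
   default value [k] is not used. *)
Definition canf k x a : O := xget k [set y | has_order_type (canF k x a) y].

End Ordinals.

Lemma well_order_wf {d : Order.disp_t} {O : orderType d} :
  wochoice.well_order (<=%O : rel O) ->
  well_founded (fun x y : O => x < y).
Proof.
move=> wo x; apply: contrapT => nx.
have [z [[zP zmin] _]] :=
  wo [pred y | `[< ~ Acc (fun x y : O => x < y) y >]] (ex_intro _ x (asboolT nx)).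
have /asboolP := zP; apply; constructor => y yz; apply: contrapT => ny.
have yP : y \in [pred y | `[< ~ Acc (fun x y : O => x < y) y >]] by exact: asboolT.
by have := zmin _ yP; rewrite leNgt yz.
Qed.

Lemma dep_funext2 (T : Type) (P : T -> Type) (Q : forall t, P t -> Type)
    (f g : forall t p, Q t p) : (forall t p, f t p = g t p) -> f = g.
Proof.
move=> fg; apply: functional_extensionality_dep => t.
by apply: functional_extensionality_dep => p; exact: fg.
Qed.

Section Stationarity.
Context {d : Order.disp_t} {O : orderType d}.
Variable wo : wochoice.well_order (<=%O : rel O).
Variable bij : O -> O -> O -> O.
Implicit Types (x z a b : O) (A S T : set O).

(* [sstat_step a reca x recx A] is the clause saying that [A] is
   [x]-s-stationary in [a]; [reca] handles the ordinals below [a], and [recx]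
   the levels below [x] at [a] itself. *)
Definition sstat_step a (reca : forall b, b < a -> O -> set O -> Prop)
    x (recx : forall z, z < x -> set O -> Prop) A : Prop :=
  is_limit a /\
  [\/ is_zero x /\ unbounded_in A a,
      [/\ ~ is_zero x, regular a, lt_card_succ x a &
        forall z (zx : z < x) S T, recx z zx S -> recx z zx T ->
          exists b (ba : b < a),
            [/\ A b, reca b ba (canf bij a z b) S
                   & reca b ba (canf bij a z b) T]]
    | [/\ ~ is_zero x, ~ regular a, x < a &
        forall z (zx : z < x) S T, recx z zx S -> recx z zx T ->
          exists b (ba : b < a),
            [/\ A b, reca b ba z S & reca b ba z T]] ].

Definition sstat_at : O -> O -> set O -> Prop :=
  Fix (well_order_wf wo) (fun=> O -> set O -> Prop) (fun a reca =>
    Fix (well_order_wf wo) (fun=> set O -> Prop) (sstat_step reca)).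

Definition s_stationary x A a := sstat_at a x A.

Definition s_reflecting x a := s_stationary x (seg a) a.

Lemma s_stationaryE x A a : s_stationary x A a =
  @sstat_step a (fun b _ y B => s_stationary y B b)
              x (fun z _ B => s_stationary z B a) A.
Proof.
have E c : sstat_at c = Fix (well_order_wf wo) (fun=> set O -> Prop)
    (@sstat_step c (fun b _ => sstat_at b)).
  by rewrite /sstat_at Fix_eq // => e f g fg; rewrite (dep_funext2 fg).
rewrite {1}/s_stationary E Fix_eq; last first.
  by move=> y f g fg; rewrite (dep_funext2 fg).
congr (sstat_step _ _ A); apply: dep_funext2 => z _.
by rewrite -E.
Qed.

End Stationarity.

(* [T] with the topology generated by [B] as a subbasis. *)
Definition gen_space (T : Type) (B : set_system T) : Type := T.

HB.instance Definition _ (T : choiceType) (B : set_system T) :=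
  Choice.on (gen_space B).
HB.instance Definition _ (T : choiceType) (B : set_system T) :=
  isSubBaseTopological.Build (gen_space B) B id.

Definition gen_limit (T : choiceType) (B : set_system T) (A : set T) : set T :=
  limit_point (A : set (gen_space B)).

Lemma gen_limitS (T : choiceType) (B : set_system T) (A A' : set T) :
  A `<=` A' -> gen_limit B A `<=` gen_limit B A'.
Proof.
by move=> AA' t At U /At[y [yt Ay Uy]]; exists y; split => //; exact: AA'.
Qed.

Lemma gen_limitU (T : choiceType) (B : set_system T) (A A' : set T) :
  gen_limit B (A `|` A') `<=` gen_limit B A `|` gen_limit B A'.
Proof.
move=> t AA't; apply: contrapT => /not_orP[].
rewrite /gen_limit not_limit_pointE => -[U tU AU].
rewrite not_limit_pointE => -[V tV AV].
have [y [yt [Ay|Ay] [Uy Vy]]] := AA't _ (filterI tU tV).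
- by have /= ye := AU y (conj Ay Uy); rewrite ye eqxx in yt.
- by have /= ye := AV y (conj Ay Vy); rewrite ye eqxx in yt.
Qed.

Section Topologies.
Context {d : Order.disp_t} {O : orderType d}.
Variable wo : wochoice.well_order (<=%O : rel O).
Variable bij : O -> O -> O -> O.
Variable mu : O.
Implicit Types (x z : O).

(* The ordinal [mu] as the set of its elements. *)
Definition below : Type := {y : O | y < mu}.
HB.instance Definition _ := Choice.on below.

Implicit Types (A U : set below) (a : below).

Definition base0 : set_system below := [set U |
  U = [set y | is_zero (val y)] \/
  exists a b : O, [/\ a < b, b <= mu & U = [set y | a < val y < b]]].

Definition base_step x (rec : forall z, z < x -> set_system below) :
    set_system below := [set U |
  [\/ is_zero x /\ base0 U,
      exists z (zx : z < x), is_succ z x /\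
        (rec z zx U \/ exists A, U = gen_limit (rec z zx) A)
    | is_limit x /\ exists z (zx : z < x), rec z zx U] ].

(* The subbasis of [tau_x]; meaningful for [x < mu]. *)
Definition base : O -> set_system below :=
  Fix (well_order_wf wo) (fun=> set_system below) base_step.

Lemma baseE x : base x = base_step (fun z (_ : z < x) => base z).
Proof.
by rewrite {1}/base Fix_eq // => y f g fg; rewrite (dep_funext2 fg).
Qed.

(* The subbasis of the auxiliary topology [T_x(a)], from the operators [rec]
   of levels below [x]. *)
Definition local_base x (rec : forall z, z < x -> set below -> set below) a :
    set_system below := [set U | base0 U \/
  exists z (zx : z < x), canF bij mu x (val a) z /\ exists A, U = rec z zx A].

Definition dop_step x (rec : forall z, z < x -> set below -> set below) A :
    set below :=
  if x < mu then gen_limit (base x) A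
  else [set a | gen_limit (local_base rec a) A a].

(* The operator [d_x], meaningful for [x < mu^+]. *)
Definition dop : O -> set below -> set below :=
  Fix (well_order_wf wo) (fun=> set below -> set below) dop_step.

Lemma dopE x : dop x = dop_step (fun z (_ : z < x) => dop z).
Proof.
by rewrite {1}/dop Fix_eq // => y f g fg; rewrite (dep_funext2 fg).
Qed.

Lemma dop_geE x A a : ~~ (x < mu) ->
  dop x A a = gen_limit (@local_base x (fun z _ => dop z) a) A a.
Proof. by move=> /negbTE xmu; rewrite dopE /dop_step xmu. Qed.

Definition tau_open x : set_system below :=
  if x < mu then [set U | open (U : set (gen_space (base x)))]
  else [set U | dop x (~` U) `<=` ~` U].

Lemma tau_openT x : tau_open x setT.
Proof.
rewrite /tau_open; case: ifPn => xmu; first exact: (@openT (gen_space _)).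
by rewrite /= setCT => a; rewrite dop_geE // => /(_ setT filterT)[y []].
Qed.

Lemma tau_openI x : setI_closed (tau_open x).
Proof.
rewrite /tau_open; case: ifPn => xmu U V /=.
  exact: (@openI (gen_space (base x)) U V).
move=> oU oV a; rewrite dop_geE // setCI => aUV.
have [aU|aV] := gen_limitU aUV.
- by left; apply: oU; rewrite dop_geE.
- by right; apply: oV; rewrite dop_geE.
Qed.

Lemma tau_open_bigU x (I : Type) (f : I -> set below) :
  (forall i, tau_open x (f i)) -> tau_open x (\bigcup_i f i).
Proof.
rewrite /tau_open; case: ifPn => xmu /= fo.
  by apply: (@bigcup_open (gen_space (base x)) I setT f) => i _; exact: fo.
move=> a; rewrite dop_geE // => da [i _ fia].
apply: (fo i a) => //; rewrite dop_geE //.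
by apply: gen_limitS da => y nUy fiy; apply: nUy; exists i.
Qed.

End Topologies.

(* The space [mu] with the topology [tau_x]. *)
Definition tau_space {d : Order.disp_t} {O : orderType d}
    (wo : wochoice.well_order (<=%O : rel O)) (bij : O -> O -> O -> O)
    (mu x : O) : Type := below mu.

Section TauSpace.
Context {d : Order.disp_t} {O : orderType d}.
Variables (wo : wochoice.well_order (<=%O : rel O)) (bij : O -> O -> O -> O).
Variables mu x : O.

HB.instance Definition _ := Choice.on (tau_space wo bij mu x).
HB.instance Definition _ := @isOpenTopological.Build (tau_space wo bij mu x)
  (tau_open wo bij x) (@tau_openT _ _ wo bij mu x) (@tau_openI _ _ wo bij mu x)
  (@tau_open_bigU _ _ wo bij mu x).

Lemma tau_spaceE : (@open (tau_space wo bij mu x)) = tau_open wo bij x.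
Proof. by []. Qed.

End TauSpace.

(* Main.v *)
From mathcomp Require Import finmap.
Require Import Defs.
Import Order.TTheory.
Local Open Scope classical_set_scope.
Local Open Scope order_scope.

Set Implicit Arguments.
Unset Strict Implicit.
Unset Printing Implicit Defensive.

(* Write F_x(a) for [canF bij mu x a] and f_x(a) for its order type. For
   x < mu the topology tau_x is generated by the intervals and the sets d_z(A)
   with z in F_x(a) = x, so all the operators d_x have the same local
   description. By induction on x one finds a club C_x such that, for all a in
   C_x, the point a is in d_x(A) iff A is f_x(a)-s-stationary in a.

   Club many a are coherent: whenever z is in F_x(a), F_z(a) is the part of
   F_x(a) below z, and a lies in C_z and is a limit of C_z. For such a, since
   d_z d_z <= d_z on every set, the traces of the sets d_z(S) below a are
   directed as soon as any two sets having a in d_z have a common d_z-limit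
   point below a. Hence a is in d_x(A) iff such a common point exists in A for
   all z in F_x(a); this is the clause defining s-stationarity, because the
   ordinals below f_x(a) are the f_z(a) with z in F_x(a), and the canonical
   functions of a and of mu agree on a club of a when a is regular.

   If mu <= x and a is singular, then f_x(a) >= a, so that no set is
   f_x(a)-s-stationary in a, and a is isolated because T_x(a) refines
   tau_(e+1), where e < a is the length of a cofinal map. *)

(** * Well-ordered types: recursion, regularity and clubs of closure points *)

Section WellOrder.
Context {d : Order.disp_t} {O : orderType d}.
Context (wo : wochoice.well_order (<=%O : rel O)).
Implicit Types (a b c e k x y z : O) (S T A U X : set O).

Lemma wo_ind (P : O -> Prop) :
  (forall x, (forall y, y < x -> P y) -> P x) -> forall x, P x.
Proof. exact: (well_founded_ind (well_order_wf wo)). Qed.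

Lemma ex_least (P : O -> Prop) : (exists x, P x) ->
  exists2 x, P x & forall y, P y -> x <= y.
Proof.
move=> [x0 Px0]; apply: contrapT => nP.
elim/wo_ind: x0 Px0 => x IH Px; apply: nP; exists x => // y Py.
by rewrite leNgt; apply/negP => /IH; exact.
Qed.

Lemma ex_succ x y : x < y -> exists s, [/\ x < s, s <= y &
  forall z, x < z -> s <= z].
Proof.
move=> xy; have [|s xs smin] := @ex_least (fun z => x < z); first by exists y.
by exists s; split => //; exact: smin.
Qed.

Lemma limit_between a x : is_limit a -> x < a -> exists2 z, x < z & z < a.
Proof. by move=> [_ /(_ x)] H /H[z /andP[]]; exists z. Qed.

Lemma limit_nonempty a : is_limit a -> exists x, x < a.
Proof. by case. Qed.

Lemma zero_or_pos x : is_zero x \/ exists z, z < x.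
Proof.
have [h|/existsNP[y /negP]] := EM (is_zero x); first by left.
by rewrite -ltNge; right; exists y.
Qed.

Lemma ex_zero : O -> exists z : O, is_zero z.
Proof.
move=> x; have [|z _ zmin] := @ex_least setT; first by exists x.
by exists z => y; exact: zmin.
Qed.

Lemma zero_succ_limit x :
  [\/ is_zero x, exists2 z, z < x & is_succ z x | is_limit x].
Proof.
have [|[y yx]] := zero_or_pos x; first by constructor 1.
have [[z zx zs]|ns] := EM (exists2 z, z < x & is_succ z x).
  by constructor 2; exists z.
constructor 3; split; first by exists y.
move=> z zx; apply: contrapT => nz; apply: ns; exists z => //; split => // t zt.
by rewrite leNgt; apply/negP => tx; apply: nz; exists t; rewrite zt.
Qed.

Lemma ex_max x y a : x < a -> y < a -> exists2 z, z < a & x <= z /\ y <= z.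
Proof.
by move=> xa ya; have [xy|/ltW yx] := leP x y; [exists y|exists x].
Qed.

Lemma regular_sup mu e (g : O -> O) : regular mu -> e < mu ->
  (forall y, y < e -> g y < mu) ->
  exists2 s, s < mu & forall y, y < e -> g y < s.
Proof.
move=> [lmu reg] emu gmu; have [s smu sup] := reg e emu g gmu.
have [t st tmu] := limit_between lmu smu; exists t => // y ye.
exact: le_lt_trans (sup y ye) st.
Qed.

(** [R y c s] constrains the value [s] at [y] in terms of the values of [c] below [y]. Existence of
    an admissible [s] is only asked after an admissible history, so invariants such as boundedness
    can be part of [R]. *)
Lemma wf_recursion mu (R : O -> (O -> O) -> O -> Prop) :
  (forall y (c c' : O -> O) s, (forall z, z < y -> c z = c' z) ->
     R y c s -> R y c' s) ->
  (forall y (c : O -> O), y < mu -> (forall z, z < y -> R z c (c z)) ->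
     exists s, R y c s) ->
  exists c : O -> O, forall y, y < mu -> R y c (c y).
Proof.
move=> Rext Rex.
(* [ext] makes a partial history total; the default [mu] is harmless because [R] reads only values
   below [y]. *)
pose ext y (rec : forall z, z < y -> O) z :=
  if @idP (z < y) is ReflectT h then rec z h else mu.
pose step y (rec : forall z, z < y -> O) : O :=
  xget mu [set s | R y (ext y rec) s].
pose c := Fix (well_order_wf wo) (fun=> O) step.
have cE y : c y = xget mu [set s | R y (ext y (fun z _ => c z)) s].
  by rewrite {1}/c Fix_eq // => z f g fg; rewrite (dep_funext2 fg).
have extE y z : z < y -> ext y (fun z _ => c z) z = c z.
  by rewrite /ext; case: {-}_ / idP.
exists c; elim/wo_ind => y IH ymu.
have [s Rs] : exists s, R y c s.
  by apply: Rex => // z zy; apply: IH => //; exact: lt_trans ymu.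
rewrite cE; apply: (Rext y (ext y (fun z _ => c z))); first exact: extE.
apply: (@xgetPex _ mu [set s | R y (ext y (fun z _ => c z)) s]); exists s.
by apply: Rext Rs => z zy; rewrite extE.
Qed.

(** A Skolem function [q] for [Q] is dominated on each square below [y] by [f y]. Iterating [f]
    along the limit [w < mu] gives a chain bounded in [mu], and its supremum is closed under [q]. *)
Lemma closure_point (mu w c0 : O) (Q : O -> O -> O -> Prop) :
  regular mu -> is_limit w -> w < mu -> c0 < mu ->
  (forall i j, i < mu -> j < mu -> exists2 k, k < mu & Q i j k) ->
  exists a, [/\ a < mu, is_limit a, c0 < a &
    forall i j, i < a -> j < a -> exists2 k, k < a & Q i j k].
Proof.
move=> rmu lw wmu c0mu Qex.
have [q qP] : {q : O -> O -> O & forall i j, i < mu -> j < mu ->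
    q i j < mu /\ Q i j (q i j)}.
  have [q qP] : {q : O * O -> O & forall p, p.1 < mu -> p.2 < mu ->
      q p < mu /\ Q p.1 p.2 (q p)}.
    apply: (@choice _ _ (fun p k => p.1 < mu -> p.2 < mu ->
      k < mu /\ Q p.1 p.2 k)) => -[i j] /=.
    have [imu|] := EM (i < mu); last by exists mu.
    have [jmu|] := EM (j < mu); last by exists mu.
    by have [k kmu Qk] := Qex i j imu jmu; exists k.
  by exists (fun i j => q (i, j)) => i j; exact: (qP (i, j)).
have [f fP] : {f : O -> O & forall y, y < mu -> [/\ y < f y, f y < mu &
    forall i j, i < y -> j < y -> q i j < f y]}.
  apply: (@choice _ _ (fun y s => y < mu -> [/\ y < s, s < mu &
    forall i j, i < y -> j < y -> q i j < s])) => y.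
  have [ymu|] := EM (y < mu); last by exists mu.
  (* Regularity is used twice: [r i] bounds the row [q i], and then one ordinal bounds all the
     [r i]. *)
  have [r rP] : {r : O -> O & forall i, i < y -> r i < mu /\
      forall j, j < y -> q i j < r i}.
    apply: (@choice _ _ (fun i s => i < y -> s < mu /\
      forall j, j < y -> q i j < s)) => i.
    have [iy|] := EM (i < y); last by exists mu.
    have [|s smu sP] := @regular_sup mu y (q i) rmu ymu; last by exists s.
    by move=> j jy; have [] := qP i j (lt_trans iy ymu) (lt_trans jy ymu).
  have [|s smu sP] := @regular_sup mu y r rmu ymu; first by move=> i /rP[].
  have [t tmu [st yt]] := ex_max smu ymu.
  have [u tu umu] := limit_between rmu.1 tmu.
  exists u => _; split=> [||i j iy jy] //; first exact: le_lt_trans tu.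
  have [_ /(_ j jy) qr] := rP i iy.
  apply: lt_trans qr _; apply: lt_le_trans (sP i iy) _.
  exact: le_trans (ltW tu).
(* The chain starts above [c0], and each term dominates [f] of all earlier ones. *)
have [|y c ymu IH|c cP] := @wf_recursion mu
    (fun y (c : O -> O) s => [/\ c0 < s, s < mu & forall z, z < y ->
      f (c z) <= s]).
- by move=> y c c' s cc' [? ? sP]; split => // z zy; rewrite -cc' //; exact: sP.
- have [|s smu sP] := @regular_sup mu y (fun z => f (c z)) rmu ymu.
    by move=> z /IH[_ cmu _]; have [] := fP _ cmu.
  have [t tmu [st c0t]] := ex_max smu c0mu.
  have [u tu umu] := limit_between rmu.1 tmu.
  exists u; split=> [||z zy] //; first exact: le_lt_trans tu.
  by apply: ltW; apply: lt_trans (sP z zy) _; exact: le_lt_trans tu.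
have cmu y : y < w -> c y < mu by move=> yw; have [] := cP y (lt_trans yw wmu).
have cinc y z : y < z -> z < w -> f (c y) <= c z.
  by move=> yz zw; have [_ _] := cP z (lt_trans zw wmu); exact.
have [s0 s0mu s0P] := regular_sup rmu wmu cmu.
have [|a aP amin] := @ex_least (fun s => forall y, y < w -> c y <= s).
  by exists s0 => y /s0P/ltW.
have amu : a < mu by apply: le_lt_trans s0mu; apply: amin => y /s0P/ltW.
have clt y : y < w -> f (c y) < a.
  move=> yw; have [z yz zw] := limit_between lw yw.
  have [u zu uw] := limit_between lw zw.
  have [fz _ _] := fP _ (cmu z zw).
  apply: le_lt_trans (cinc _ _ yz zw) _; apply: lt_le_trans fz _.
  by apply: le_trans (aP u uw); exact: cinc.
have cof x : x < a -> exists2 y, y < w & x < c y.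
  move=> xa; apply: contrapT => nx; move: xa; rewrite ltNge => /negP; apply.
  apply: amin => y yw; rewrite leNgt; apply/negP => xc; apply: nx;
    exists y => //.
have [y0 y0w] := limit_nonempty lw.
exists a; split => //.
- split; first by exists (f (c y0)); exact: clt.
  move=> x /cof[y yw xy]; exists (c y); rewrite xy /=.
  by apply: lt_trans (clt y yw); have [] := fP _ (cmu y yw).
- have [c0c _ _] := cP _ (lt_trans y0w wmu).
  by apply: lt_trans c0c _; apply: lt_trans (clt y0 y0w);
    have [] := fP _ (cmu y0 y0w).
- move=> i j ia ja; have [y ya [iy jy]] := ex_max ia ja.
  have [z zw yz] := cof y ya.
  have [_ _ fz] := fP _ (cmu z zw).
  have [qi Qq] := qP i j (lt_trans ia amu) (lt_trans ja amu).
  exists (q i j) => //; apply: lt_trans (clt z zw).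
  by apply: fz; exact: le_lt_trans yz.
Qed.

(** At a limit of closure points, any two ordinals [i], [j] already lie below one closure point,
    which supplies the witness. Recording [w < a] allows the same construction to be run later
    inside a regular [a]. *)
Lemma closure_club (mu w : O) (Q : O -> O -> O -> Prop) :
  regular mu -> is_limit w -> w < mu ->
  (forall i j, i < mu -> j < mu -> exists2 k, k < mu & Q i j k) ->
  club [set a | [/\ a < mu, is_limit a, w < a &
    forall i j, i < a -> j < a -> exists2 k, k < a & Q i j k]] mu.
Proof.
move=> rmu lw wmu Qex; split.
- by move=> a [].
- move=> y ymu; have [c cmu [yc wc]] := ex_max ymu wmu.
  have [a [amu la ca Qa]] := closure_point rmu lw wmu cmu Qex.
  exists a; last by rewrite amu (le_trans yc (ltW ca)).
  by split => //; exact: le_lt_trans ca.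
- move=> a amu la au.
  have cof x : x < a -> exists2 b, [/\ b < mu, is_limit b, w < b &
      forall i j, i < b -> j < b ->
        exists2 k, k < b & Q i j k] & x < b /\ b < a.
    move=> /(limit_between la)[y xy /au[b bP /andP[yb ba]]]; exists b => //.
    by split => //; exact: lt_le_trans yb.
  have [x0 /cof[b0 [_ _ wb0 _] [_ b0a]]] := limit_nonempty la.
  split => //; first exact: lt_trans b0a.
  move=> i j ia ja; have [x xa [ix jx]] := ex_max ia ja.
  have [b [_ _ _ Qb] [xb ba]] := cof x xa.
  have [k kb Qk] := Qb i j (le_lt_trans ix xb) (le_lt_trans jx xb).
  by exists k => //; exact: lt_trans ba.
Qed.

End WellOrder.

(** * Neighbourhoods in a topology generated by a subbasis *)

Section GenSpace.
Context (T : choiceType) (B : set_system T).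

(** A neighbourhood contains a finite intersection of subbasic sets around [t], so closure under
    intersections and supersets reduces everything to the subbasis. *)
Lemma gen_space_nbhs_ind (t : T) (P : set_system T) :
  P setT -> (forall U V, P U -> P V -> P (U `&` V)) ->
  (forall U V, U `<=` V -> P U -> P V) ->
  (forall U, B U -> U t -> P U) ->
  forall U, nbhs (t : gen_space B) U -> P U.
Proof.
move=> PT PI PS PB U; rewrite nbhsE => -[V [[D Dfin <-] Dt] VU].
have [W DW Wt] := Dt; have WU : W `<=` U by move=> s Ws; apply: VU; exists W.
apply: (PS _ _ WU); have [E EB WE] := Dfin _ DW; rewrite -WE.
have {}Wt i : [set` E] i -> i t by move=> iE; move: Wt; rewrite -WE; exact.
have {}EB i : [set` E] i -> B i by move=> /EB; rewrite inE.
rewrite bigcap_fset big_seq; elim/big_ind: _ => // i iE.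
exact: PB (EB i iE) (Wt i iE).
Qed.

Lemma gen_space_nbhs_subbase (t : T) U : B U -> U t -> nbhs (t : gen_space B) U.
Proof.
move=> BU Ut; apply: (@open_nbhs_nbhs (gen_space B)); split => //.
exists [set U]; last by rewrite bigcup_set1.
move=> _ ->; exact: finI_from1.
Qed.

End GenSpace.

(** * Monotonicity and continuity of the canonical functions *)

Section CanF.
Context {d : Order.disp_t} {O : orderType d}.
Context (bij : O -> O -> O -> O) (hbij : fixed_bijections bij).
Implicit Types (a b c k x y z : O).

Lemma lt_card_succ_lt x y k : y < x -> lt_card_succ x k -> lt_card_succ y k.
Proof.
move=> yx; apply: card_le_trans; apply: subset_card_le => z zy.
exact: lt_trans yx.
Qed.

Lemma lt_lt_card_succ x k : x <= k -> lt_card_succ x k.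
Proof. by move=> xk; apply: subset_card_le => z zx; exact: lt_le_trans xk. Qed.

Lemma canF_small k x a : x < k -> canF bij k x a = seg x.
Proof. by rewrite /canF => ->. Qed.

Lemma canF_large k x a : k <= x -> canF bij k x a = bij k x @` seg a.
Proof. by rewrite /canF ltNge => ->. Qed.

Lemma canF_lt k x a z : regular k -> lt_card_succ x k -> a <= k ->
  canF bij k x a z -> z < x.
Proof.
move=> rk xk ak; have [xlt|kx] := ltP x k; first by rewrite canF_small.
rewrite canF_large // => -[y ya <-].
by have [f _ _] := hbij.1 k x rk kx xk; apply: f; exact: lt_le_trans ak.
Qed.

Lemma canF_mono k x a b : a <= b -> canF bij k x a `<=` canF bij k x b.
Proof.
move=> ab; have [xlt|kx] := ltP x k; first by rewrite !canF_small.
by rewrite !canF_large // => _ [y ya <-]; exists y => //; exact: lt_le_trans ab.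
Qed.

(** For limit [a], [seg a] is the union of the smaller segments, and taking images preserves this
    union. *)
Lemma canF_cont k x a z : is_limit a -> canF bij k x a z ->
  exists2 c, c < a & canF bij k x c z.
Proof.
move=> la; have [xlt|kx] := ltP x k.
  by have [c ca] := limit_nonempty la; rewrite canF_small => // ?;
    exists c => //; rewrite canF_small.
rewrite canF_large // => -[y ya <-]; have [c yc ca] := limit_between la ya.
by exists c => //; rewrite canF_large //; exists y.
Qed.

End CanF.

(** * A uniform local description of the operators *)

Section Limits.
Context {d : Order.disp_t} {O : orderType d}.
Context (wo : wochoice.well_order (<=%O : rel O)).
Context (bij : O -> O -> O -> O) (hbij : fixed_bijections bij).
Context (mu : O) (hmu : regular mu).
Implicit Types (a b c x y z : O) (S A U V W : set O).
Local Notation F := (canF bij mu).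
Local Notation dop := (dop wo bij (mu := mu)).

(** Unfolding the recursion, the subbasis at [x < mu] accumulates [base0] and all sets [dop z A]
    with [z < x], and [canF bij mu x] is constantly [seg x]. Hence the levels below and above [mu]
    can be treated alike. *)
Lemma base_localE x (t : below mu) : x < mu ->
  base wo x = local_base bij (fun z (_ : z < x) => dop z) t.
Proof.
elim/(wo_ind wo): x => x IH xmu.
have dE z (A : set (below mu)) : z < mu -> dop z A = gen_limit (base wo z) A.
  by move=> zmu; rewrite dopE /dop_step zmu.
rewrite baseE; apply/seteqP; split=> U.
- case.
  + by move=> [_ U0]; left.
  + move=> [z [zx [zs]]] [|[A ->]]; last first.
      right; exists z, zx; rewrite canF_small //; split => //; exists A.
      by rewrite dE // (lt_trans zx xmu).
    rewrite IH ?(lt_trans zx xmu) // => -[U0|]; first by left.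
    move=> [y [yz [_ [A ->]]]]; right; exists y, (lt_trans yz zx).
    by rewrite canF_small //; split; [exact: lt_trans zx|exists A].
  + move=> [_ [z [zx]]]; rewrite IH ?(lt_trans zx xmu) // => -[U0|];
      first by left.
    move=> [y [yz [_ [A ->]]]]; right; exists y, (lt_trans yz zx).
    by rewrite canF_small //; split; [exact: lt_trans zx|exists A].
- have [x0 | [z zx zs] | lx] := zero_succ_limit x.
  + case=> [U0|]; first by constructor 1.
    by move=> [z [zx]]; have := x0 z; rewrite leNgt zx.
  + move=> H; constructor 2; exists z, zx; split => //.
    case: H => [U0|[y [yx [_ [A ->]]]]].
      by left; rewrite IH ?(lt_trans zx xmu) //; left.
    have [yz|zy|<-] := ltgtP y z.
    * left; rewrite IH ?(lt_trans zx xmu) //; right; exists y, yz.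
      by rewrite canF_small ?(lt_trans zx xmu) //; split => //; exists A.
    * by have := zs.2 _ zy; rewrite leNgt yx.
    * by right; exists A; rewrite dE // (lt_trans yx xmu).
  + move=> H; constructor 3; split => //.
    case: H => [U0|[y [yx [_ [A ->]]]]].
      have [z zx] := limit_nonempty lx; exists z, zx.
      by rewrite IH ?(lt_trans zx xmu) //; left.
    have [z yz zx] := limit_between lx yx; exists z, zx.
    rewrite IH ?(lt_trans zx xmu) //; right; exists y, yz.
    by rewrite canF_small ?(lt_trans zx xmu) //; split => //; exists A.
Qed.

Lemma dop_local x (A : set (below mu)) t :
  dop x A t = gen_limit (local_base bij (fun z (_ : z < x) => dop z) t) A t.
Proof.
have [xmu|mux] := ltP x mu; last by rewrite propeqE dop_geE // -leNgt.
by rewrite dopE /dop_step xmu -base_localE.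
Qed.

(** Transports [dop] to subsets of [O], which avoids the subtype [below mu]; elements of [S] outside
    [mu] have no effect. *)
Definition dlim x S : set O :=
  [set a | exists2 t : below mu, val t = a & dop x (val @^-1` S) t].

(* The neighbourhoods of [a] in [T_x(a)], up to points outside [mu]. *)
Inductive tnbhs x a : set O -> Prop :=
| tnbhs_setT : tnbhs x a setT
| tnbhs_lt c : a < c -> tnbhs x a [set y | y < c]
| tnbhs_gt c : c < a -> tnbhs x a [set y | c < y]
| tnbhs_dlim z S : F x a z -> dlim z S a -> tnbhs x a (dlim z S)
| tnbhsI U V : tnbhs x a U -> tnbhs x a V -> tnbhs x a (U `&` V)
| tnbhsS U V : U `<=` V -> tnbhs x a U -> tnbhs x a V.

Lemma val_image_preimage (B : set (below mu)) : val @^-1` (val @` B) = B.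
Proof.
apply/seteqP; split => [t [s Bs /val_inj<-]|t Bt] //.
by exists t.
Qed.

Lemma dlim_lt x S a : dlim x S a -> a < mu.
Proof. by move=> [t <- _]; exact: (svalP t). Qed.

Lemma tnbhs_nbhs x U (t : below mu) : lt_card_succ x mu -> tnbhs x (val t) U ->
  nbhs (t : gen_space (local_base bij (fun z (_ : z < x) => dop z) t))
    (val @^-1` U).
Proof.
move=> hx; pose B := local_base bij (fun z (_ : z < x) => dop z) t.
have nS (P Q : set (below mu)) : P `<=` Q ->
    nbhs (t : gen_space B) P -> nbhs (t : gen_space B) Q.
  by move=> PQ; exact: filterS.
elim=> {U} [|c ac|c ca|z S Fz [s /val_inj st ds]|U V _ nU _ nV|U V UV _ nU].
- exact: filterT.
(* Among the sets of [base0], an initial segment is available only around zero, as the singleton;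
   elsewhere an interval with left end [z] below [val t] is used, with right end the smaller of [c]
   and [mu]. *)
- have [b [tb bmu bc]] : exists b, [/\ val t < b, b <= mu & b <= c].
    have [cmu|/ltW muc] := leP c mu; first by exists c.
    by exists mu; split => //; exact: (svalP t).
  have [z0|[z zt]] := zero_or_pos (val t).
    apply: (nS [set y : below mu | is_zero (val y)]).
      by move=> y /= y0; exact: le_lt_trans ac.
    by apply: gen_space_nbhs_subbase => //; left; left.
  apply: (nS [set y : below mu | z < val y < b]).
    by move=> y /andP[_ yb]; exact: lt_le_trans bc.
  apply: gen_space_nbhs_subbase => /=; last by rewrite zt.
  by left; right; exists z, b; split => //; exact: lt_trans tb.
- apply: (nS [set y : below mu | c < val y < mu]).
    by move=> y /andP[].
  apply: gen_space_nbhs_subbase => /=; last by rewrite ca; exact: (svalP t).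
  left; right; exists c, mu; split => //.
  by apply: lt_trans (svalP t).
- rewrite st in ds; apply: (nS (dop z (val @^-1` S))).
    by move=> y dy; exists y.
  apply: gen_space_nbhs_subbase => //; right.
  exists z, (canF_lt hbij hmu hx (ltW (svalP t)) Fz); split => //.
  by exists (val @^-1` S).
- exact: filterI.
- by apply: nS nU => y; exact: UV.
Qed.

(** With [tnbhs_nbhs], this identifies the two notions of neighbourhood. The set in the conclusion
    is the largest subset of [O] with trace [V]: points outside [mu] belong to it vacuously. *)
Lemma nbhs_tnbhs x (V : set (below mu)) (t : below mu) :
  nbhs (t : gen_space (local_base bij (fun z (_ : z < x) => dop z) t)) V ->
  tnbhs x (val t) [set y | forall h : y < mu, V (exist _ y h)].
Proof.
move: V; apply: gen_space_nbhs_ind.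
- by apply: tnbhsS (tnbhs_setT _ _).
- move=> U V nU nV; apply: tnbhsS (tnbhsI nU nV) => y [Uy Vy] h; split.
  + exact: Uy.
  + exact: Vy.
- by move=> U V UV nU; apply: tnbhsS nU => y Uy h; apply: UV; exact: Uy.
- move=> U [[->|[a [b [ab bmu ->]]]]|[z [zx [Fz [A ->]]]]].
  (* The singleton of zero contains the initial segment below the successor [s] of [t]. *)
  + move=> /= t0; have [s [ts smu smin]] := ex_succ wo (svalP t).
    apply: tnbhsS (tnbhs_lt x ts) => y /= ys h z.
    by apply: le_trans (t0 z); rewrite leNgt; apply/negP => /smin;
      rewrite leNgt ys.
  + move=> /= /andP[at_ tb];
      apply: tnbhsS (tnbhsI (tnbhs_gt x at_) (tnbhs_lt x tb)).
    by move=> y /= [-> ->].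
  + move=> dt; apply: (@tnbhsS _ _ (dlim z (val @` A))).
      move=> y [s <-]; rewrite val_image_preimage => ds h.
      by have -> : exist _ (val s) h = s by exact: val_inj.
    by apply: tnbhs_dlim => //; exists t => //; rewrite val_image_preimage.
Qed.

(** If [s] is the successor of [a], then [[set y | y < s]] is a neighbourhood of [a], so only points
    below [a] can witness a limit. *)
Lemma dlimP x S a : lt_card_succ x mu ->
  dlim x S a <-> a < mu /\ forall U, tnbhs x a U ->
    exists2 y, y < a & S y /\ U y.
Proof.
move=> hx; split=> [[t <-]|[amu nP]].
- rewrite dop_local => dt; split; first exact: (svalP t).
  move=> U nU; have [s [ts _ smin]] := ex_succ wo (svalP t).
  have [y [/eqP yt Sy [Uy ys]]] :=
    dt _ (tnbhs_nbhs hx (tnbhsI nU (tnbhs_lt x ts))).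
  exists (val y) => //; rewrite ltNge le_eqVlt; apply/negP => /orP[/eqP ty|].
    by apply: yt; exact: val_inj.
  by move=> /smin; rewrite leNgt ys.
- exists (exist _ a amu) => //;
    rewrite dop_local => U /nbhs_tnbhs /nP[y ya [Sy Uy]].
  exists (exist _ y (lt_trans ya amu)); split => //.
  by apply/eqP => /(congr1 val) /= ya'; rewrite ya' ltxx in ya.
Qed.

End Limits.

(** * Calculus of limit points, coherence and pair reflection *)

Section LimitCalculus.
Context {d : Order.disp_t} {O : orderType d}.
Context (wo : wochoice.well_order (<=%O : rel O)).
Context (bij : O -> O -> O -> O) (hbij : fixed_bijections bij).
Context (mu : O) (hmu : regular mu).
Implicit Types (a b c e s x y z : O) (S T A U V W C : set O).
Local Notation F := (canF bij mu).
Local Notation dlim := (dlim wo bij mu).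
Local Notation tnbhs := (tnbhs wo bij mu).
Local Notation dlimP := (dlimP wo hbij hmu).

Lemma dlim_limit x S a : lt_card_succ x mu -> dlim x S a -> is_limit a.
Proof.
move=> hx /(dlimP _ _ hx)[amu nP]; split.
  by have [y ya _] := nP _ (tnbhs_setT _ _ _ _ _); exists y.
by move=> c ca; have [y ya [_ /= cy]] := nP _ (tnbhs_gt _ _ _ _ ca);
  exists y; rewrite cy.
Qed.

Lemma dlim_unbounded x S a c : lt_card_succ x mu -> dlim x S a -> c < a ->
  exists y, [/\ S y, c < y & y < a].
Proof.
move=> hx /(dlimP _ _ hx)[amu nP] ca.
by have [y ya [Sy cy]] := nP _ (tnbhs_gt _ _ _ _ ca); exists y.
Qed.

Lemma dlim_tnbhs x S U a : lt_card_succ x mu -> dlim x S a -> tnbhs x a U ->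
  dlim x (S `&` U) a.
Proof.
move=> hx /(dlimP _ _ hx)[amu nP] nU; apply/(dlimP _ _ hx); split => // V nV.
by have [y ya [Sy [Uy Vy]]] := nP _ (tnbhsI nU nV); exists y.
Qed.

Lemma subset_dlim x S T a : lt_card_succ x mu -> S `<=` T -> dlim x S a ->
  dlim x T a.
Proof.
move=> hx ST /(dlimP _ _ hx)[amu nP]; apply/(dlimP _ _ hx); split => // V nV.
by have [y ya [Sy Vy]] := nP _ nV; exists y => //; split => //; exact: ST.
Qed.

Lemma tnbhs_subset x z a U : F z a `<=` F x a -> tnbhs z a U -> tnbhs x a U.
Proof.
move=> zx; elim=> {U} [|c ca|c ca|y S Fy Ly|U V _ ? _ ?|U V UV _].
- exact: tnbhs_setT.
- exact: tnbhs_lt.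
- exact: tnbhs_gt.
- by apply: tnbhs_dlim => //; exact: zx.
- exact: tnbhsI.
- exact: tnbhsS.
Qed.

Lemma dlim_subset x z S a : lt_card_succ x mu -> lt_card_succ z mu ->
  F z a `<=` F x a -> dlim x S a -> dlim z S a.
Proof.
move=> hx hz zx /(dlimP _ _ hx)[amu nP]; apply/(dlimP _ _ hz); split => // U.
by move=> /(tnbhs_subset zx); exact: nP.
Qed.

(* Every neighbourhood of [a] is a neighbourhood of all points below [a] of some
   neighbourhood of [a], by continuity of [c |-> F x c] at [a]. *)
Lemma dlim_idem x S a : lt_card_succ x mu -> dlim x (dlim x S) a -> dlim x S a.
Proof.
move=> hx La; have la := dlim_limit hx La.
have H U : tnbhs x a U ->
    exists2 W, tnbhs x a W & forall c, c < a -> W c -> tnbhs x c U.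
  elim=> {U} [|c ca|c ca|z T Fz Lz|U V _ [U' nU' UP] _ [V' nV' VP]|
      U V UV _ [W nW WP]].
  - by exists setT; [exact: tnbhs_setT|move=> *; exact: tnbhs_setT].
  - exists setT; first exact: tnbhs_setT.
    by move=> b ba _; apply: tnbhs_lt; exact: lt_trans ca.
  - by exists [set y | c < y]; [exact: tnbhs_gt|move=> b _ cb; exact: tnbhs_gt].
  - have [c ca Fc] := canF_cont la Fz.
    exists ([set y | c < y] `&` dlim z T); first by apply: tnbhsI;
      [exact: tnbhs_gt|exact: tnbhs_dlim].
    by move=> b ba [cb Lb]; apply: tnbhs_dlim => //;
      apply: canF_mono (ltW cb) _ Fc.
  - exists (U' `&` V'); first exact: tnbhsI.
    by move=> c ca [U'c V'c]; apply: tnbhsI; [exact: UP|exact: VP].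
  - by exists W => // c ca Wc; apply: tnbhsS UV _; exact: WP.
apply/(dlimP _ _ hx); split; first exact: dlim_lt La.
move=> U /H[W nW WP]; have [_ /(_ W nW)[c ca [Lc Wc]]] := (dlimP _ _ hx).1 La.
have [_ /(_ U (WP c ca Wc))[y yc SU]] := (dlimP _ _ hx).1 Lc.
by exists y => //; exact: lt_trans ca.
Qed.

(** The inclusion makes level [x] finer than level [z] at [a], so the outer limit can be lowered to
    level [z] and removed by idempotence. *)
Lemma dlim_absorb x z S a : lt_card_succ x mu -> lt_card_succ z mu ->
  F z a `<=` F x a -> dlim x (dlim z S) a -> dlim z S a.
Proof.
by move=> hx hz zx La; apply: dlim_idem => //; exact: dlim_subset La.
Qed.

(** At level zero no set [dlim y T] enters, so every neighbourhood of [a] contains an end segment of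
    [a]. *)
Lemma dlim_zero z S a : is_zero z -> is_limit a -> a < mu ->
  (forall c, c < a -> exists y, [/\ S y, c < y & y < a]) -> dlim z S a.
Proof.
move=> z0 la amu uS; have zmu : z < mu by apply: le_lt_trans amu; exact: z0.
have hz := lt_lt_card_succ (ltW zmu).
suff H U : tnbhs z a U -> exists2 c, c < a & forall y, c < y -> y < a -> U y.
  apply/(dlimP _ _ hz); split => // U /H[c ca cU].
  by have [y [Sy cy ya]] := uS c ca; exists y => //; split => //; exact: cU.
have [x0 x0a] := limit_nonempty la.
elim=> {U} [|c ca|c ca|y T|U V _ [c ca cU] _ [b ba bV]|U V UV _ [c ca cU]].
- by exists x0.
- by exists x0 => // y _ ya; exact: lt_trans ca.
- by exists c.
- by rewrite canF_small //= => yz; have := z0 y; rewrite leNgt yz.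
- have [e ea [ce be]] := ex_max ca ba; exists e => // y ey ya.
  by split; [apply: cU|apply: bV] => //; apply: le_lt_trans ey.
- by exists c => // y cy ya; apply: UV; exact: cU.
Qed.

(** Used with [dlim_gtE] to push reflection points above a prescribed [c] by truncating one of the
    sets. *)
Lemma dlim_gt x S a c : lt_card_succ x mu -> c < a -> dlim x S a ->
  dlim x (S `&` [set y | c < y]) a.
Proof. by move=> hx ca La; apply: dlim_tnbhs => //; exact: tnbhs_gt. Qed.

Lemma dlim_gtE x S b c : lt_card_succ x mu ->
  dlim x (S `&` [set y | c < y]) b ->
  dlim x S b /\ c < b.
Proof.
move=> hx Lb; split; first by apply: subset_dlim Lb => // y [].
have [y0 y0b] := limit_nonempty (dlim_limit hx Lb).
by have [y [[_ cy] _ yb]] := dlim_unbounded hx Lb y0b; exact: lt_trans yb.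
Qed.

(* A point with a cofinal map of length [e] is isolated in [tau_(e+1)]: for [l]
   the least such length and [D] a cofinal set of order type [l], a limit point
   of [D] below [a] has cofinality less than [l], hence by induction does not
   belong to [d_l(mu)]. *)
Lemma cofinal_not_dlim a e x S (g : O -> O) : e < x -> x < mu ->
  (forall y, y < e -> g y < a) ->
  (forall s, s < a -> exists2 y, y < e & s < g y) -> ~ dlim x S a.
Proof.
elim/(wo_ind wo): a e x S g => a IH e x S g ex xmu ga gcof La.
have hx := lt_lt_card_succ (ltW xmu); have la := dlim_limit hx La.
have amu := dlim_lt La.
pose P l := exists f : O -> O, (forall y, y < l -> f y < a) /\
  forall s, s < a -> exists2 y, y < l & s < f y.
have [|l [f [fa fcof]] lmin] := @ex_least _ _ wo P; first by exists e, g.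
have lx : l < x by apply: le_lt_trans ex; apply: lmin; exists g.
have hl := lt_lt_card_succ (ltW (lt_trans lx xmu)).
(* Minimality of [l]: a map from a shorter length into [a] is bounded. *)
have bnd i (f' : O -> O) : i < l -> (forall j, j < i -> f' j < a) ->
    exists2 s, s < a & forall j, j < i -> f' j <= s.
  move=> il f'a; apply: contrapT => unb; have : l <= i;
    last by rewrite leNgt il.
  apply: lmin; exists f'; split => // s sa; apply: contrapT => ns; apply: unb.
  by exists s => // j ji; rewrite leNgt; apply/negP => sj; apply: ns; exists j.
(* [h] is a nondecreasing map above [f], still with values below [a]. *)
have [|y c yl cP|h hP] := @wf_recursion _ _ wo l
    (fun y (c : O -> O) s =>
      [/\ s < a, f y <= s & forall z, z < y -> c z <= s]).
- move=> y c c' s cc' [sa fs cs]; split => // z zy.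
  by rewrite -cc' //; exact: cs.
- have [|s sa sP] := bnd y c yl; first by move=> j /cP[].
  have [t ta [st ft]] := ex_max sa (fa y yl).
  by exists t; split => // z zy; apply: le_trans (sP z zy) st.
have [z z0] := ex_zero wo a; pose D := [set h y | y in [set y | y < l]].
have zmu : z < mu by apply: le_lt_trans amu; exact: z0.
have hz := lt_lt_card_succ (ltW zmu).
have LD : dlim z D a.
  apply: dlim_zero => // c /fcof[y yl cy]; have [hy fh _] := hP y yl.
  by exists (h y); split => //; [exists y|exact: lt_le_trans fh].
have Ll : dlim l S a.
  by apply: dlim_subset La => //;
    rewrite !canF_small ?(lt_trans lx) // => y /= /lt_trans; exact.
(* Both levels [z] and [l] are below [x], so this intersection is a neighbourhood of [a] at level
   [x]. *)
have nU : tnbhs x a (dlim z D `&` dlim l S).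
  by apply: tnbhsI; apply: tnbhs_dlim => //; rewrite canF_small //;
    exact: le_lt_trans lx.
have [_ /(_ _ nU)[b ba [_ [LDb Llb]]]] := (dlimP _ _ hx).1 La.
have lb := dlim_limit hl Llb.
(* [h] maps [i] into [b]; it is cofinal there because [b] is a limit of [D]. The induction
   hypothesis then applies at [b] with length [i] and level [l]. *)
have [|i [il bi] imin] := @ex_least _ _ wo (fun i => i < l /\ b <= h i).
  by have [y yl by_] := fcof b ba; have [_ fh _] := hP y yl; exists y;
    split => //; apply: le_trans fh; exact: ltW.
apply: (IH b ba i l S h il (lt_trans lx xmu)) Llb.
- move=> j ji; rewrite ltNge; apply/negP => bj.
  have : i <= j by apply: imin; split => //; exact: lt_trans il.
  by rewrite leNgt ji.
- move=> s sb; have [_ [[y yl <-] sy yb]] := dlim_unbounded hz LDb sb.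
  exists y => //; rewrite ltNge; apply/negP;
    rewrite le_eqVlt => /orP[/eqP iy|iy].
    by rewrite iy leNgt yb in bi.
  have [_ _ /(_ i iy) hh] := hP y yl.
  by have := le_trans bi hh; rewrite leNgt yb.
Qed.

(* The clubs [C z] witness coherence at the points below [a] to which sets
   reflect. *)
Record coherent_at x a (C : O -> set O) : Prop := CoherentAt {
  coh_zero : exists2 z, is_zero z & F x a z;
  coh_F : forall z, F x a z -> forall y, F z a y <-> F x a y /\ y < z;
  coh_club : forall z, F x a z -> club (C z) mu;
  coh_unbounded : forall z, F x a z -> unbounded_in (C z) a;
  coh_C : forall z b, F x a z -> C z b -> forall y, F z b y -> F y b `<=` F z b
}.

Definition pair_reflecting x A a := forall z, F x a z -> forall S T,
  dlim z S a -> dlim z T a ->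
    exists b, [/\ b < a, A b, dlim z S b & dlim z T b].

Section Coherence.
Context (x a : O) (C : O -> set O).
Context (hx : lt_card_succ x mu) (amu : a < mu) (la : is_limit a).
Context (coh : coherent_at x a C).

Let hF z : F x a z -> lt_card_succ z mu.
Proof. by move=> /(canF_lt hbij hmu hx (ltW amu)) zx;
  exact: lt_card_succ_lt hx. Qed.

(** Intersect [S] with the limit points of [C z]. These form a neighbourhood of [a] at level [z],
    since zero is in [F z a] when [z] is positive; a limit of limit points of [C z] lies in [C z] by
    closedness. *)
Lemma dlim_club z S : F x a z -> dlim z S a -> (exists y, y < z) ->
  exists S', [/\ S' `<=` S, dlim z S' a & forall b, b < a -> dlim z S' b ->
    C z b].
Proof.
move=> Fz Lz [y yz]; have [o o0 Fo] := coh_zero coh; have hz := hF Fz.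
have oz : o < z by exact: le_lt_trans (o0 y) yz.
have [Csub Cunb Ccl] := coh_club coh Fz.
have Cub c : c < mu -> dlim o (C z) c -> C z c.
  move=> cmu Lc; apply: Ccl => //; first exact: dlim_limit (hF Fo) Lc.
  by move=> s sc; have [t [Ct st tc]] := dlim_unbounded (hF Fo) Lc sc;
    exists t => //; rewrite (ltW st).
exists (S `&` dlim o (C z)); split; first by move=> s [].
- apply: dlim_tnbhs => //; apply: tnbhs_dlim; first by apply/(coh_F coh Fz).
  apply: dlim_zero => // c ca; have [e ce ea] := limit_between la ca.
  have [t Ct /andP[et ta]] := coh_unbounded coh Fz ea.
  by exists t; split => //; exact: lt_le_trans et.
- move=> b ba Lb; have bmu := lt_trans ba amu.
  apply: Ccl => //; first exact: dlim_limit hz Lb.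
  move=> s sb; have [t [[_ Lt] st tb]] := dlim_unbounded hz Lb sb.
  by exists t; [apply: Cub => //; exact: lt_trans bmu|rewrite (ltW st)].
Qed.

(** Cut [S] down by [dlim_club] and intersect it with [dlim y T], a neighbourhood of [a] at level
    [z]. At a limit point [b] in [C z] above [c], [y] is in [F z b], so [coh_C] and [dlim_absorb]
    turn a limit of [dlim y T] into a limit of [T]. *)
Lemma dlim_merge z y S T : F x a z -> F x a y -> y < z -> dlim z S a ->
  dlim y T a ->
  exists S' c, [/\ c < a, dlim z S' a &
    forall b, b < a -> c < b -> dlim z S' b -> dlim z S b /\ dlim y T b].
Proof.
move=> Fz Fy yz LS LT; have Fzy : F z a y by apply/(coh_F coh Fz).
have hz := hF Fz; have hy := hF Fy.
have [|S' [S'S LS' S'C]] := dlim_club Fz LS; first by exists y.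
have [c ca Fc] := canF_cont la Fzy.
exists (S' `&` dlim y T), c; split => //; first by apply: dlim_tnbhs => //;
  exact: tnbhs_dlim.
move=> b ba cb Lb.
have LbS' : dlim z S' b by apply: subset_dlim Lb => // s [].
split; first exact: subset_dlim LbS'.
apply: (dlim_absorb hz hy); last by apply: subset_dlim Lb => // s [].
by apply: (coh_C coh Fz (S'C b ba LbS')); exact: canF_mono (ltW cb) _ Fc.
Qed.

Definition basic_tnbhs z U :=
  exists2 c, c < a & (forall b, c < b -> b < a -> U b) \/
  exists y S, [/\ F z a y, dlim y S a & forall b, c < b -> b < a ->
    dlim y S b -> U b].

(* Intersections of two sets [d_y(S1)], [d_y(S2)] of the same level are handled
   by [d_y(d_y(S1) `&` d_y(S2))], nonempty below [a] by pair reflection. *)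
Lemma tnbhs_basic z U : pair_reflecting x setT a -> F x a z \/ z = x ->
  tnbhs z a U -> basic_tnbhs z U.
Proof.
move=> refl; elim/(wo_ind wo): z U => z IH U Fz.
have FxF y : F z a y -> F x a y.
  by case: Fz => [Fz|->//] /(coh_F coh Fz)[].
have hz : lt_card_succ z mu by case: Fz => [/hF|->].
have [x0 x0a] := limit_nonempty la.
elim=> {U} [|c ca|c ca|y S Fy Ly|U V _ [c ca HU] _ [e ea HV]|U V UV _
    [c ca HU]].
- by exists x0 => //; left.
- by exists x0 => //; left => b _ ba; exact: lt_trans ca.
- by exists c => //; left.
- by exists x0 => //; right; exists y, S.
- have [m ma [cm em]] := ex_max ca ea.
  case: HU => [HU|[y1 [S1 [Fy1 L1 HU]]]].
    exists m => //; case: HV => [HV|[y2 [S2 [Fy2 L2 HV]]]].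
      by left => b mb ba; split; [apply: HU|apply: HV] => //;
        apply: le_lt_trans mb.
    right; exists y2, S2; split => // b mb ba Lb.
    by split; [apply: HU|apply: HV] => //; apply: le_lt_trans mb.
  case: HV => [HV|[y2 [S2 [Fy2 L2 HV]]]].
    exists m => //; right; exists y1, S1; split => // b mb ba Lb.
    by split; [apply: HU|apply: HV] => //; apply: le_lt_trans mb.
  have [Fx1 Fx2] := (FxF _ Fy1, FxF _ Fy2).
  have [y12|y21|y12] := ltgtP y1 y2.
  + have [S' [c' [c'a LS' HS']]] := dlim_merge Fx2 Fx1 y12 L2 L1.
    have [n na [mn c'n]] := ex_max ma c'a.
    exists n => //; right; exists y2, S'; split => // b nltb ba Lb.
    have [|L2b L1b] := HS' b ba _ Lb; first exact: le_lt_trans nltb.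
    have mb := le_lt_trans mn nltb.
    by split; [apply: HU|apply: HV] => //; apply: le_lt_trans mb.
  + have [S' [c' [c'a LS' HS']]] := dlim_merge Fx1 Fx2 y21 L1 L2.
    have [n na [mn c'n]] := ex_max ma c'a.
    exists n => //; right; exists y1, S'; split => // b nltb ba Lb.
    have [|L1b L2b] := HS' b ba _ Lb; first exact: le_lt_trans nltb.
    have mb := le_lt_trans mn nltb.
    by split; [apply: HU|apply: HV] => //; apply: le_lt_trans mb.
  + move: L2 HV Fx2; rewrite -y12 => L2 HV _ {Fy2 y12 y2}; have h1 := hF Fx1.
    exists m => //; right; exists y1, (dlim y1 S1 `&` dlim y1 S2);
      split => //; last first.
      move=> b mb ba Lb; split.
        apply: HU => //; first exact: le_lt_trans mb.
        by apply: dlim_idem => //; apply: subset_dlim Lb => // s [].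
      apply: HV => //; first exact: le_lt_trans mb.
      by apply: dlim_idem => //; apply: subset_dlim Lb => // s [].
    (* By induction on the level, [W] may be taken basic at level [y1]. It is either an end segment
       or given by a lower level [w < y1]; the latter is merged into [S1] before reflecting. *)
    apply/(dlimP _ _ h1); split => // W nW.
    have y1z := canF_lt hbij hmu hz (ltW amu) Fy1.
    have [k ka [HW|[w [T [Fw LT HW]]]]] := IH y1 y1z W (or_introl Fx1) nW.
      have [b [ba _ /(dlim_gtE h1)[L1b kb] L2b]] :=
        refl y1 Fx1 _ _ (dlim_gt h1 ka L1) L2.
      by exists b => //; split => //; exact: HW.
    have [Fxw wy1] := (coh_F coh Fx1 w).1 Fw.
    have [S' [c' [c'a LS' HS']]] := dlim_merge Fx1 Fxw wy1 L1 LT.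
    have [n na [kn c'n]] := ex_max ka c'a.
    have [b [ba _ /(dlim_gtE h1)[LSb nltb] L2b]] :=
      refl y1 Fx1 _ _ (dlim_gt h1 na LS') L2.
    have [|L1b LTb] := HS' b ba _ LSb; first exact: le_lt_trans nltb.
    by exists b => //; split => //; apply: HW => //; exact: le_lt_trans nltb.
- exists c => //; case: HU => [HU|[y [S [Fy Ly HU]]]].
    by left => b cb ba; apply: UV; exact: HU.
  by right; exists y, S; split => // b cb ba Lb; apply: UV; exact: HU.
Qed.

(** Two sets [dlim z S] and [dlim z T] intersect in a neighbourhood of [a]; conversely, by
    [tnbhs_basic] one such set, truncated, lies inside any neighbourhood below [a]. *)
Lemma dlim_pair_reflecting A : dlim x A a <-> pair_reflecting x A a.
Proof.
split=> [LA z Fz S T LS LT|refl].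
  have nU : tnbhs x a (dlim z S `&` dlim z T) by apply: tnbhsI;
    exact: tnbhs_dlim.
  by have [_ /(_ _ nU)[b ba [Ab [LSb LTb]]]] := (dlimP _ _ hx).1 LA; exists b.
apply/(dlimP _ _ hx); split => // U nU.
have refl1 : pair_reflecting x setT a.
  by move=> z Fz S T LS LT; have [b [ba _ ? ?]] := refl z Fz S T LS LT;
    exists b.
have [c ca [HU|[y [S [Fy LS HU]]]]] := tnbhs_basic refl1 (or_intror erefl) nU.
  (* An end segment is handled at level zero: a limit point of the points above [c] is above [c]. *)
  have [o o0 Fo] := coh_zero coh.
  have LT : dlim o setT a.
    by apply: dlim_zero => // e /(limit_between la)[s es sa]; exists s.
  have [b [ba Ab /(dlim_gtE (hF Fo))[_ cb] _]] :=
    refl o Fo _ _ (dlim_gt (hF Fo) ca LT) LT.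
  by exists b => //; split => //; exact: HU.
have [b [ba Ab /(dlim_gtE (hF Fy))[LSb cb] _]] :=
  refl y Fy _ _ (dlim_gt (hF Fy) ca LS) LS.
by exists b => //; split => //; exact: HU.
Qed.

End Coherence.
End LimitCalculus.

(** * Order types and the values of canonical functions *)

Section OrderTypes.
Context {d : Order.disp_t} {O : orderType d}.
Context (wo : wochoice.well_order (<=%O : rel O)).
Implicit Types (a b k m s t x y z : O) (X Y : set O).

(** [g] is the collapse, inverse to the enumeration; unlike the enumeration, it restricts directly
    to initial parts of [X]. *)
Lemma has_order_typeP X x : has_order_type X x <->
  exists g : O -> O, [/\ forall z, X z -> g z < x,
    forall y z, X y -> X z -> y < z -> g y < g z &
    forall t, t < x -> exists2 z, X z & g z = t].
Proof.
split=> [[h [[hX _ hs] hmono]]|[g [gx gmono gs]]].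
- have [g gP] : {g : O -> O & forall z, X z -> g z < x /\ h (g z) = z}.
    apply: (@choice _ _ (fun z t => X z -> t < x /\ h t = z)) => z.
    have [Xz|nXz] := EM (X z); last by exists x.
    by have [t tx <-] := hs z Xz; exists t.
  exists g; split=> [z /gP[]//|y z Xy Xz yz|t tx].
    have [[gyx hy] [gzx hz]] := (gP y Xy, gP z Xz).
    rewrite ltNge le_eqVlt; apply/negP => /orP[/eqP e|e].
      by rewrite -hy -hz e ltxx in yz.
    by have := lt_trans (hmono _ _ gzx gyx e); rewrite hy hz => /(_ _ yz);
      rewrite ltxx.
  exists (h t); first exact: hX.
  have [gx e] := gP (h t) (hX t tx).
  have [lt|lt|//] := ltgtP (g (h t)) t.
    by have := hmono _ _ gx tx lt; rewrite e ltxx.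
  by have := hmono _ _ tx gx lt; rewrite e ltxx.
- have [h hP] : {h : O -> O & forall t, t < x -> X (h t) /\ g (h t) = t}.
    apply: (@choice _ _ (fun t z => t < x -> X z /\ g z = t)) => t.
    have [tx|ntx] := EM (t < x); last by exists x.
    by have [z Xz <-] := gs t tx; exists z.
  have hmono y z : y < x -> z < x -> y < z -> h y < h z.
    move=> yx zx yz; have [[Xy gy] [Xz gz]] := (hP y yx, hP z zx).
    rewrite ltNge le_eqVlt; apply/negP => /orP[/eqP e|e].
      by rewrite -gy -gz e ltxx in yz.
    by have := gmono _ _ Xz Xy e; rewrite gy gz => /(lt_trans yz); rewrite ltxx.
  exists h; split => //; split.
  + by move=> t /hP[].
  + move=> s t; rewrite !inE => /hP[_ gs'] /hP[_ gt] e.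
    by rewrite -gs' -gt e.
  + move=> z Xz; exists (g z); first exact: gx.
    have [Xh e] := hP _ (gx z Xz).
    have [lt|lt|//] := ltgtP (h (g z)) z.
      by have := gmono _ _ Xh Xz lt; rewrite e ltxx.
    by have := gmono _ _ Xz Xh lt; rewrite e ltxx.
Qed.

Lemma le_increasing x (e : O -> O) :
  (forall y z, y < x -> z < x -> y < z -> e y < e z) ->
  forall z, z < x -> z <= e z.
Proof.
move=> emono; elim/(wo_ind wo) => z IH zx; rewrite leNgt; apply/negP => ez.
have ezx := lt_trans ez zx.
by have := IH _ ez ezx; rewrite leNgt emono.
Qed.

(** Enumerating [X] and collapsing [Y] gives an increasing map from [x] into [y], and an increasing
    map never lowers an ordinal. *)
Lemma order_type_le X Y x y : X `<=` Y ->
  has_order_type X x -> has_order_type Y y -> x <= y.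
Proof.
move=> XY [h [[hX _ _] hmono]] /has_order_typeP[g [gy gmono _]].
rewrite leNgt; apply/negP => yx.
have := @le_increasing x (g \o h) _ y yx; rewrite leNgt /= gy.
  move=> /(_ _)/negP; apply => // s t sx tx st.
  by apply: gmono; [apply: XY; exact: hX|apply: XY; exact: hX|exact: hmono].
by apply: XY; exact: hX.
Qed.

Lemma order_type_unique X x y :
  has_order_type X x -> has_order_type X y -> x = y.
Proof. by move=> Xx Xy; apply/le_anti;
  rewrite !(order_type_le (X := X) (Y := X)). Qed.

Lemma order_type_seg x : has_order_type (seg x) x.
Proof. by exists id; split => //; split => // y yx; exists y. Qed.

Lemma order_type_initial X x (g : O -> O) t :
  (forall z, X z -> g z < x) ->
  (forall y z, X y -> X z -> y < z -> g y < g z) ->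
  (forall t, t < x -> exists2 z, X z & g z = t) ->
  X t -> has_order_type (X `&` seg t) (g t).
Proof.
move=> gx gmono gs Xt; apply/has_order_typeP; exists g; split.
- by move=> z [Xz zt]; exact: gmono.
- by move=> y z [Xy _] [Xz _]; exact: gmono.
- move=> s st; have [z Xz e] := gs s (lt_trans st (gx t Xt)).
  exists z => //; split => //; rewrite /seg /= ltNge le_eqVlt;
    apply/negP => /orP[/eqP tz|tz].
    by rewrite -e -tz ltxx in st.
  by have := lt_trans st (gmono _ _ Xt Xz tz); rewrite e ltxx.
Qed.

(** Collapse by recursion: [p y] is the least strict upper bound of [p] on the part of [X] below
    [y]. The bound [p y <= y] ensures that these values exist in [O]. *)
Lemma order_type_exists X m : X `<=` seg m -> exists x, has_order_type X x.
Proof.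
move=> Xm.
have [|y p ym pP|p pP] :=
  @wf_recursion _ _ wo m (fun y (p : O -> O) s => [/\ s <= y,
    forall z, z < y -> X z -> p z < s &
    forall t, (forall z, z < y -> X z -> p z < t) -> s <= t]).
- move=> y p p' s pp' [sy ps smin]; split => // [z zy Xz|t tP].
    by rewrite -pp' //; exact: ps.
  by apply: smin => z zy Xz; rewrite pp' //; exact: tP.
- have py z : z < y -> X z -> p z < y.
    by move=> zy _; have [pz _ _] := pP z zy; exact: le_lt_trans zy.
  have [|s sP smin] := @ex_least _ _ wo (fun s => forall z, z < y -> X z ->
    p z < s).
    by exists y.
  by exists s; split => //; exact: smin.
have pm z : X z -> p z < m.
  by move=> /[dup] /Xm zm _; have [pz _ _] := pP z zm; exact: le_lt_trans zm.
have [|x xP xmin] := @ex_least _ _ wo (fun x => forall z, X z -> p z < x).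
  by exists m.
exists x; apply/has_order_typeP; exists p; split => //.
- by move=> y z Xy Xz yz; have [_ + _] := pP z (Xm z Xz); apply.
- move=> t tx; apply: contrapT => nt.
  have [|z [Xz tz] zmin] := @ex_least _ _ wo (fun z => X z /\ t <= p z).
    apply: contrapT => nz; have : x <= t; last by rewrite leNgt tx.
    by apply: xmin => z Xz; rewrite ltNge; apply/negP => tp; apply: nz;
      exists z.
  have [_ _ pmin] := pP z (Xm z Xz).
  have pt : p z <= t.
    apply: pmin => y yz Xy; rewrite ltNge; apply/negP => ty.
    by have := zmin y (conj Xy ty); rewrite leNgt yz.
  by apply: nt; exists z => //; apply/le_anti; rewrite pt tz.
Qed.

Context (bij : O -> O -> O -> O) (hbij : fixed_bijections bij).
Local Notation F := (canF bij).
Local Notation f := (canf bij).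

Lemma canfP k x a : regular k -> lt_card_succ x k -> a <= k ->
  has_order_type (F k x a) (f k x a).
Proof.
move=> rk xk ak.
apply: (@xgetPex _ k [set y | has_order_type (F k x a) y]).
apply: (@order_type_exists _ x) => z; exact: canF_lt.
Qed.

Lemma canf_eq k x a y : regular k -> lt_card_succ x k -> a <= k ->
  has_order_type (F k x a) y -> f k x a = y.
Proof. by move=> rk xk ak; exact/order_type_unique/canfP. Qed.

Lemma canf_small k x a : x < k -> f k x a = x.
Proof.
move=> xk; apply: (@order_type_unique (seg x)); last exact: order_type_seg.
rewrite /canf canF_small //;
  apply: (@xgetPex _ k [set y | has_order_type (seg x) y]).
by exists x; exact: order_type_seg.
Qed.

Section Coherence.
Context (k x a : O) (rk : regular k) (xk : lt_card_succ x k) (ak : a <= k).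
Context (coh : forall z, F k x a z ->
  forall y, F k z a y <-> F k x a y /\ y < z).

Lemma canF_initial z : F k x a z -> F k z a = F k x a `&` seg z.
Proof. by move=> Fz; apply/seteqP; split=> y /(coh Fz). Qed.

(** Coherence makes [F k z a] the part of [F k x a] below [z], so the collapse of [F k x a] sends
    [z] to [f k z a]. *)
Lemma coherent_canf_lt z : F k x a z -> f k z a < f k x a.
Proof.
move=> Fz; have zx := canF_lt hbij rk xk ak Fz.
have [g [gx gm gs]] := (has_order_typeP _ _).1 (canfP rk xk ak).
rewrite (@canf_eq k z a (g z)) //; first exact: gx.
  exact: lt_card_succ_lt xk.
by rewrite canF_initial //; exact: order_type_initial gs Fz.
Qed.

Lemma coherent_canf_surj y : y < f k x a ->
  exists2 z, F k x a z & y = f k z a.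
Proof.
have [g [gx gm gs]] := (has_order_typeP _ _).1 (canfP rk xk ak).
move=> /gs[z Fz <-]; exists z => //; symmetry; apply: canf_eq => //.
  by apply: lt_card_succ_lt xk; exact: canF_lt Fz.
by rewrite canF_initial //; exact: order_type_initial gs Fz.
Qed.

End Coherence.

(** For [k <= x] the order type is that of an image of [seg a], hence has at most the cardinality of
    [a]. *)
Lemma canf_lt_card_succ k x a : regular k -> lt_card_succ x k -> a < k ->
  (x < k -> x <= a) -> lt_card_succ (f k x a) a.
Proof.
move=> rk xk ak; have [xlt /(_ isT) xa|kx _] := ltP x k.
  by rewrite canf_small //; exact: lt_lt_card_succ.
have [g [gx gm gs]] := (has_order_typeP _ _).1 (canfP rk xk (ltW ak)).
apply: card_le_trans (card_image_le (g \o bij k x) (seg a)).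
apply: subset_card_le => t /gs[z]; rewrite canF_large // => -[i ia <-] e.
by exists i.
Qed.

(* Both [canf k x b] and [canf a (canf k x a) b] are order types of images of
   [b] under bijections of [a] with the same set, up to an order isomorphism. *)
Lemma canf_reflect k x a : regular k -> regular a -> a < k -> k <= x ->
  lt_card_succ x k -> a <= f k x a ->
  exists Q : O -> O -> Prop, (forall i, i < a -> exists2 j, j < a & Q i j) /\
    forall b, b <= a -> (forall i, i < b -> exists2 j, j < b & Q i j) ->
      f a (f k x a) b = f k x b.
Proof.
move=> rk ra ak kx xk az; set z := f k x a in az *.
have zP : has_order_type (F k x a) z := canfP rk xk (ltW ak).
have za : lt_card_succ z a.
  by apply: canf_lt_card_succ => //; rewrite ltNge kx.
have [h [[hX hinj hs] hmono]] := zP.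
have [bX _ bs] := hbij.1 a z ra az za.
(* Here [j] bounds the indices needed to match the [i]-th values of the two bijections in both
   directions along [h]; on a [b] closed under this relation, [h] maps [F a z b] onto [F k x b]. *)
exists (fun i j => exists j1 j2, [/\ j1 <= j, j2 <= j,
  bij k x j1 = h (bij a z i) &
  h (bij a z j2) = bij k x i]); split.
- move=> i ia.
  have [j1 j1a e1] : (bij k x @` seg a) (h (bij a z i)).
    by rewrite -canF_large //; apply: hX; exact: bX.
  have [t tz et] : (h @` seg z) (bij k x i).
    by apply: hs; rewrite canF_large //; exists i.
  have [j2 j2a e2] := bs t tz.
  have [j ja [j1j j2j]] := ex_max j1a j2a.
  by exists j => //; exists j1, j2; split => //; rewrite e2.
- move=> b ba Qb; apply: canf_eq => //.
  have bk := le_trans ba (ltW ak).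
  suff hE : h @` F a z b = F k x b.
    have [g [gx gm gs]] := (has_order_typeP _ _).1 (canfP rk xk bk).
    apply/has_order_typeP; exists (g \o h); split.
    + by move=> y Fy; apply: gx; rewrite -hE; exists y.
    + have Fz y : F a z b y -> y < z by exact: canF_lt.
      move=> y y' Fy Fy' yy'; apply: gm; rewrite -?hE;
        [by exists y|by exists y'|].
      by apply: hmono => //; exact: Fz.
    + by move=> t /gs[y]; rewrite -hE => -[s Fs <-] <-; exists s.
  rewrite !canF_large //; apply/seteqP; split.
  + move=> _ [_ [i ib <-] <-]; have [j jb [j1 [_ [j1j _ e _]]]] := Qb i ib.
    by exists j1 => //; exact: le_lt_trans jb.
  + move=> _ [i ib <-]; have [j jb [_ [j2 [_ j2j _ e]]]] := Qb i ib.
    by exists (bij a z j2) => //; exists j2 => //; exact: le_lt_trans jb.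
Qed.

End OrderTypes.

(** * From pair reflection to s-stationarity; levels below [mu] *)

Section Stationary.
Context {d : Order.disp_t} {O : orderType d}.
Context (wo : wochoice.well_order (<=%O : rel O)).
Context (bij : O -> O -> O -> O).
Implicit Types (a b c o x y z : O) (A B S T : set O).
Local Notation stat := (s_stationary wo bij).
Local Notation f := (canf bij).

Lemma s_stationary_limit y A b : stat y A b -> is_limit b.
Proof. by rewrite s_stationaryE => -[]. Qed.

Lemma s_stationary_zero o A b : is_zero o ->
  stat o A b <-> is_limit b /\ unbounded_in A b.
Proof.
move=> o0; rewrite s_stationaryE;
  split=> [[lb [[_ ub]|[/(_ o0)]|[/(_ o0)]]]|[lb ub]] //.
by split => //; constructor 1.
Qed.

(** At a positive level, reflect the set of points above [c] at level zero: where it is unbounded,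
    the reflection point is above [c]. *)
Lemma s_stationary_unbounded y A b : stat y A b -> unbounded_in A b.
Proof.
have [o o0] := ex_zero wo y.
move=> /[dup] /s_stationary_limit lb; rewrite s_stationaryE => -[_].
have ob : o < b by have [t] := limit_nonempty lb; exact: le_lt_trans.
have gt_stat c : c < b -> stat o [set t | c < t] b.
  move=> cb; apply/s_stationary_zero => //; split => // t tb.
  have [s sb [ts cs]] := ex_max tb cb; have [r sr rb] := limit_between lb sb.
  by exists r; [exact: le_lt_trans sr|rewrite (ltW (le_lt_trans ts sr))].
have stat_gt c b' : stat o [set t | c < t] b' -> c < b'.
  move=> /(s_stationary_zero _ _ o0)[lb' ub'];
    have [t tb'] := limit_nonempty lb'.
  by have [s cs /andP[_ sb']] := ub' t tb'; exact: lt_trans sb'.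
have pos : ~ is_zero y -> o < y.
  by move=> /existsNP[t /negP]; rewrite -ltNge; exact: le_lt_trans.
case=> [[] //|[/pos oy rb _ H]|[/pos oy _ _ H]] c cb.
- have [b' [b'b [Ab' + _]]] := H o oy _ _ (gt_stat c cb) (gt_stat c cb).
  by rewrite canf_small // => /stat_gt cb'; exists b'; rewrite ?(ltW cb').
- have [b' [b'b [Ab' + _]]] := H o oy _ _ (gt_stat c cb) (gt_stat c cb).
  by move=> /stat_gt cb'; exists b'; rewrite ?(ltW cb').
Qed.

(** The parameter [g] covers both cases of the definition: [canf bij a] for regular [a], and the
    constant function with value [y] for singular [a]. *)
Definition pair_clause (g : O -> O -> O) x A a :=
  forall y, y < x -> forall S T, stat y S a -> stat y T a ->
  exists b, [/\ b < a, A b, stat (g y b) S b & stat (g y b) T b].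

Lemma s_stationary_regular x A a : regular a -> lt_card_succ x a ->
  ~ is_zero x ->
  stat x A a <-> pair_clause (f a) x A a.
Proof.
move=> ra xa x0; rewrite s_stationaryE; split=> [[_ [[]//|[_ _ _ H]|[]//]]|H].
- move=> y yx S T yS yT; have [b [ba [Ab bS bT]]] := H y yx S T yS yT.
  by exists b.
- split; first exact: ra.1.
  constructor 2; split => // y yx S T yS yT.
  by have [b [ba Ab bS bT]] := H y yx S T yS yT; exists b, ba.
Qed.

Lemma s_stationary_singular x A a : is_limit a -> ~ regular a -> x < a ->
  ~ is_zero x ->
  stat x A a <-> pair_clause (fun y _ => y) x A a.
Proof.
move=> la ra xa x0; rewrite s_stationaryE;
  split=> [[_ [[]//|[]//|[_ _ _ H]]]|H].
- move=> y yx S T yS yT; have [b [ba [Ab bS bT]]] := H y yx S T yS yT.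
  by exists b.
- split=> //; constructor 3; split => // y yx S T yS yT.
  by have [b [ba Ab bS bT]] := H y yx S T yS yT; exists b, ba.
Qed.

Lemma s_stationary_singular_lt x A a : ~ regular a -> stat x A a -> x < a.
Proof.
move=> ra; rewrite s_stationaryE => -[la [[x0 _]|[]//|[]//]].
by have [t] := limit_nonempty la; exact: le_lt_trans.
Qed.

Context (hbij : fixed_bijections bij) (mu : O) (hmu : regular mu).
Local Notation F := (canF bij mu).
Local Notation dlim := (dlim wo bij mu).
Local Notation dlimP := (dlimP wo hbij hmu).

Section Step.
Context (x a : O) (C : O -> set O).
Context (hx : lt_card_succ x mu) (amu : a < mu) (la : is_limit a).
Context (coh : coherent_at bij mu x a C).
Context (Ca : forall z, F x a z -> C z a).
Context (IH : forall z, F x a z -> forall b, C z b -> forall S,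
  dlim z S b <-> stat (f mu z b) S b).
Context (g : O -> O -> O).

(* [E] contains the points at which sets [S'] reflect. *)
Definition reflects_on z (E : set O) :=
  (forall S, dlim z S a -> exists S', [/\ S' `<=` S, dlim z S' a &
     forall b, b < a -> is_limit b -> unbounded_in S' b -> E b]) /\
  forall b, b < a -> is_limit b -> E b -> C z b /\ g (f mu z a) b = f mu z b.

Context (refl : forall z, F x a z -> exists E, reflects_on z E).

(** Pair reflection is translated level by level with [IH], the ordinals below [f mu x a] being the
    values [f mu z a]. Shrinking [S] confines the reflection points to [E], where [IH] applies and
    [g] agrees with the canonical function of [mu]. *)
Lemma dlim_pair_clause A : dlim x A a <-> pair_clause g (f mu x a) A a.
Proof.
have hF z : F x a z -> lt_card_succ z mu.
  by move=> /(canF_lt hbij hmu hx (ltW amu)) zx; exact: lt_card_succ_lt hx.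
have Lb z S S' b : F x a z -> dlim z S' b -> is_limit b /\ unbounded_in S' b.
  move=> /hF hz LS; split; first exact: (dlim_limit hbij hmu hz LS).
  move=> c cb; have [y [Sy cy yb]] := dlim_unbounded hbij hmu hz LS cb.
  by exists y => //; rewrite (ltW cy).
split=> [/(dlim_pair_reflecting wo hbij hmu hx amu la coh) rA y yx S T yS yT|H].
- have [z Fz e] := coherent_canf_surj wo hbij hmu hx (ltW amu) (coh_F coh) yx.
  rewrite {y yx}e in yS yT *; have hz := hF z Fz.
  move: yS yT => /(IH Fz (Ca Fz)) LS /(IH Fz (Ca Fz)) LT.
  (* It suffices to shrink [S]: a common limit point of [S'] and [T] is already in [E]. *)
  have [E [E1 E2]] := refl Fz.
  have [S' [S'S LS' S'E]] := E1 S LS.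
  have [b [ba Ab bS bT]] := rA z Fz S' T LS' LT.
  have [lb ub] := Lb z S S' b Fz bS.
  have [Cb gb] := E2 b ba lb (S'E b ba lb ub).
  exists b; rewrite gb; split => //; apply/(IH Fz Cb) => //.
  exact: (subset_dlim hbij hmu hz S'S).
- apply/(dlim_pair_reflecting wo hbij hmu hx amu la coh) => z Fz S T LS LT.
  have hz := hF z Fz; have [E [E1 E2]] := refl Fz.
  have [S' [S'S LS' S'E]] := E1 S LS.
  have yx := coherent_canf_lt wo hbij hmu hx (ltW amu) (coh_F coh) Fz.
  have [b [ba Ab bS bT]] :=
    H _ yx S' T ((IH Fz (Ca Fz) _).1 LS') ((IH Fz (Ca Fz) _).1 LT).
  have lb := s_stationary_limit bS.
  have [Cb e] := E2 b ba lb (S'E b ba lb (s_stationary_unbounded bS)).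
  rewrite e in bS bT; move: bS bT => /(IH Fz Cb) bS /(IH Fz Cb) bT.
  by exists b; split => //; exact: (subset_dlim hbij hmu hz S'S).
Qed.

End Step.

(** Beyond correctness, the induction carries the inclusion that provides [coh_C] at higher levels,
    and the explicit form of the clubs below [mu]. *)
Definition correct_club x (C : set O) := [/\ club C mu,
  forall a, C a -> forall S, dlim x S a <-> stat (f mu x a) S a,
  forall a, C a -> forall y, F x a y -> F y a `<=` F x a &
  x < mu -> C = [set a | x < a < mu]].

Lemma reflects_on_tail a (C : O -> set O) (g : O -> O -> O) z :
  a < mu -> z < a -> C z = [set b | z < b < mu] -> (forall b, g z b = z) ->
  reflects_on a C g z [set b | z < b].
Proof.
move=> amu za Cz gz; have zmu := lt_trans za amu.
split=> [S LS|b ba lb /= zb]; last first.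
  by rewrite Cz /= zb (lt_trans ba amu) !canf_small.
have hz := lt_lt_card_succ (ltW zmu).
exists (S `&` [set y | z < y]); split; first by move=> y [].
  exact: (dlim_gt hbij hmu hz za LS).
move=> b ba lb ub; have [t tb] := limit_nonempty lb.
by have [s [_ zs] /andP[_ sb]] := ub t tb; exact: lt_trans sb.
Qed.

Lemma club_tail x : x < mu -> club [set a | x < a < mu] mu.
Proof.
move=> xmu; split.
- by move=> a /andP[].
- move=> y ymu; have [s smu [xs ys]] := ex_max xmu ymu.
  have [t st tmu] := limit_between hmu.1 smu; exists t.
    by rewrite /= (le_lt_trans xs st).
  by rewrite (ltW (le_lt_trans ys st)).
- move=> a amu la ua; have [t ta] := limit_nonempty la.
  have [s /andP[xs _] /andP[_ sa]] := ua t ta.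
  by rewrite /= amu (lt_trans xs sa).
Qed.

(** At points above [x] the canonical functions of all levels [z < x] are constant, so the regular
    and the singular clauses coincide and [step] serves both. Level zero is plain unboundedness. *)
Lemma correct_club_small x (Cf : O -> set O) : x < mu ->
  (forall z, z < x -> correct_club z (Cf z)) ->
  correct_club x [set a | x < a < mu].
Proof.
move=> xmu CfP; have hx := lt_lt_card_succ (ltW xmu).
split => //; first exact: club_tail; last first.
  move=> a /andP[xa amu] y; rewrite canF_small // => yx.
  by rewrite canF_small ?(lt_trans yx xmu) // => t /lt_trans; exact.
move=> a /andP[xa amu] S; rewrite canf_small //.
have [la|nla] := EM (is_limit a); last first.
  by split=> [/(dlim_limit hbij hmu hx)|/s_stationary_limit].
have [x0|nx0] := EM (is_zero x).
  rewrite s_stationary_zero //; split=> [LS|[_ ub]].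
    split => // c ca; have [y [Sy cy ya]] := dlim_unbounded hbij hmu hx LS ca.
    by exists y; rewrite ?(ltW cy).
  apply: dlim_zero => // c ca; have [e ce ea] := limit_between la ca.
  by have [t St /andP[et ta]] := ub e ea; exists t; split => //;
    exact: lt_le_trans et.
have [o o0] := ex_zero wo x.
have ox : o < x by move: nx0 => /existsNP[t /negP]; rewrite -ltNge;
  exact: le_lt_trans.
have Cfz z : z < x -> Cf z = [set b | z < b < mu].
  by move=> zx; have [_ _ _] := CfP z zx; apply; exact: lt_trans xmu.
have coh : coherent_at bij mu x a Cf.
  split.
  - by exists o => //; rewrite canF_small.
  - move=> z; rewrite (canF_small _ _ xmu) => zx y.
    rewrite (canF_small _ _ (lt_trans zx xmu)).
    by split=> [/= yz|[]]//; split => //; exact: lt_trans zx.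
  - by move=> z; rewrite canF_small // => /CfP[].
  - move=> z; rewrite canF_small // => zx y ya; rewrite Cfz //.
    have [s sa [zs ys]] := ex_max (lt_trans zx xa) ya.
    have [t st ta] := limit_between la sa.
    exists t; first by rewrite /= (le_lt_trans zs st) (lt_trans ta).
    by rewrite (ltW (le_lt_trans ys st)).
  - by move=> z b; rewrite canF_small // => /CfP[_ _ + _]; exact.
have step g : (forall z b, z < x -> g z b = z) ->
  dlim x S a <-> pair_clause g x S a.
  move=> gz; rewrite -{2}(canf_small wo bij a xmu).
  apply: (dlim_pair_clause hx amu la coh).
  - by move=> z; rewrite canF_small // => zx;
      rewrite Cfz //= amu (lt_trans zx xa).
  - by move=> z; rewrite canF_small // => /CfP[_ + _ _]; exact.
  - move=> z; rewrite canF_small // => zx; exists [set b | z < b].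
    apply: reflects_on_tail => //; [exact: lt_trans xa|exact: Cfz|].
    by move=> b; exact: gz.
have [ra|nra] := EM (regular a).
  rewrite s_stationary_regular //; last exact: lt_lt_card_succ (ltW xa).
  by apply: step => z b zx; apply: canf_small => //; exact: lt_trans xa.
by rewrite s_stationary_singular //; apply: step.
Qed.

End Stationary.

(** * Isolated points and limit points of the whole space *)

Section Isolated.
Context (T : topologicalType).

Lemma isolated_setT (a : T) : isolated setT a <-> open [set a].
Proof.
split=> [[_ [V nV]]|oa]; last first.
  split; first by rewrite inE.
  by exists [set a]; [exact: open_nbhs_nbhs|rewrite setIT].
rewrite setIT => e; rewrite e in nV; rewrite openE => y ->; exact: nV.
Qed.

Lemma limit_point_setT (a : T) : limit_point setT a <-> ~ open [set a].
Proof.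
split=> [la oa|no].
  have [|y [/eqP ya _ /= e]] := la [set a]; first exact: open_nbhs_nbhs.
  exact: ya.
apply: contrapT; rewrite not_limit_pointE => -[U nU]; rewrite setTI => Ua.
by apply: no; rewrite openE => y ->; exact: filterS nU.
Qed.

End Isolated.

(** * Levels from [mu] on, and the conclusion *)

Section Large.
Context {d : Order.disp_t} {O : orderType d}.
Context (wo : wochoice.well_order (<=%O : rel O)).
Context (bij : O -> O -> O -> O) (hbij : fixed_bijections bij).
Context (mu : O) (hmu : regular mu).
Implicit Types (a b c o w x y z : O) (A B S T : set O).
Local Notation F := (canF bij mu).
Local Notation f := (canf bij).
Local Notation dlim := (dlim wo bij mu).
Local Notation dlimP := (dlimP wo hbij hmu).
Local Notation stat := (s_stationary wo bij).
Local Notation correct_club := (correct_club wo bij mu).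

(** [E] is a club in [a] of closure points at which [canf_reflect] applies and [C z] is unbounded.
    Since zero is in [F z a], the limit points of [E] form a neighbourhood of [a], with which [S] is
    intersected. *)
Lemma reflects_on_club a (C : O -> set O) z w : regular a -> is_limit w ->
  w < a -> a < mu -> mu <= z -> lt_card_succ z mu -> seg a `<=` F z a ->
  club (C z) mu -> unbounded_in (C z) a ->
  exists E, reflects_on wo bij mu a C (f a) z E.
Proof.
move=> ra lw wa amu muz hz aF [Csub _ Ccl] Ca.
have az : a <= f mu z a.
  by apply: (order_type_le wo aF (order_type_seg a));
    exact: (canfP wo hbij hmu hz (ltW amu)).
have [Q [Qa Qf]] := canf_reflect wo hbij hmu ra amu muz hz az.
(* The argument [i] serves closure under [Q], and [j] the unboundedness of [C z]. *)
pose R i j k := (exists2 k1, k1 <= k & Q i k1) /\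
  (exists2 k2, k2 <= k & C z k2 /\ j <= k2).
have [Esub Eunb Ecl] : club [set b | [/\ b < a, is_limit b, w < b &
    forall i j, i < b -> j < b -> exists2 k, k < b & R i j k]] a.
  apply: closure_club => // i j ia ja.
  have [k1 k1a Q1] := Qa i ia; have [k2 C2 /andP[jk2 k2a]] := Ca j ja.
  have [k ka [k1k k2k]] := ex_max k1a k2a; exists k => //.
  by split; [exists k1|exists k2].
set E := [set b | _] in Esub Eunb Ecl; exists E.
have [o o0] := ex_zero wo a.
have [t ta] := limit_nonempty ra.1.
have oa : o < a by exact: le_lt_trans ta.
have omu := lt_trans oa amu; have ho := lt_lt_card_succ (ltW omu).
split=> [S LS|b ba lb [_ _ wb Rb]].
- have LE_E b : b < a -> dlim o E b -> E b.
    move=> ba Lb; apply: Ecl => //; first exact: (dlim_limit hbij hmu ho Lb).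
    move=> c cb; have [y [Ey cy yb]] := dlim_unbounded hbij hmu ho Lb cb.
    by exists y; rewrite ?(ltW cy).
  exists (S `&` dlim o E); split; first by move=> s [].
    apply: (dlim_tnbhs hbij hmu hz LS); apply: tnbhs_dlim; first exact: aF.
    apply: (dlim_zero wo hbij hmu o0 ra.1 amu) => c ca.
    have [e ce ea] := limit_between ra.1 ca.
    by have [s Es /andP[es sa]] := Eunb e ea; exists s; split => //;
      exact: lt_le_trans es.
  move=> b ba lb ub; apply: Ecl => // c cb.
  have [s [_ Ls] /andP[cs sb]] := ub c cb.
  by exists s; rewrite ?cs //; apply: LE_E => //; exact: lt_trans ba.
- split.
  + apply: Ccl => //; first exact: lt_trans amu.
    move=> c cb; have [k kb [_ [k2 k2k [Ck2 ck2]]]] := Rb c c cb cb.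
    by exists k2; rewrite ?ck2 //=; exact: le_lt_trans kb.
  + apply: Qf; first exact: ltW.
    move=> i ib; have [k kb [[k1 k1k Q1] _]] := Rb i i ib ib.
    by exists k1 => //; exact: le_lt_trans kb.
Qed.

Lemma correct_club_large w x (Cf : O -> set O) : is_limit w -> w < mu ->
  mu <= x -> lt_card_succ x mu -> (forall z, z < x -> correct_club z (Cf z)) ->
  exists C, correct_club x C.
Proof.
move=> lw wmu mux hx CfP.
have [bx _ bs] := hbij.1 mu x hmu mux hx.
have hz z : z < x -> lt_card_succ z mu by move=> zx; exact: lt_card_succ_lt hx.
pose e := bij mu x.
(* The clauses say that [seg a] is contained in [F x a], that [F x a] has no
   other elements below [mu], that [F z a] and the part of [F x a] below [z]
   contain each other, and that [Cf z] is unbounded in [a], for [z = e i] in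
   [F x a]. *)
pose R i j k := [/\ exists2 l, l <= k & e l = i,
  e i < mu -> e i <= k,
  mu <= e i -> exists2 l, l <= k & e l = bij mu (e i) j,
  mu <= e i -> e j < e i -> exists2 l, l <= k & bij mu (e i) l = e j &
  exists2 l, l <= k & Cf (e i) l /\ j <= l].
have Rex i j : i < mu -> j < mu -> exists2 k, k < mu & R i j k.
  move=> imu jmu; have ex : e i < x by exact: bx.
  have [l1 l1mu e1] : (e @` seg mu) i by apply: bs; exact: lt_le_trans mux.
  have [l2 l2mu e2] : exists2 l, l < mu & (e i < mu -> e i <= l).
    by have [eimu|muei] := ltP (e i) mu;
      [exists (e i)|exists i => // /lt_geF; rewrite muei].
  have [l3 l3mu e3] : exists2 l, l < mu & (mu <= e i -> e l = bij mu (e i) j).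
    have [eimu|muei] := ltP (e i) mu; first by exists i => // /le_gtF;
      rewrite eimu.
    have [by_ _ _] := hbij.1 mu (e i) hmu muei (hz _ ex).
    have [l lmu el] : (e @` seg mu) (bij mu (e i) j).
      by apply: bs; apply: lt_trans ex; exact: by_.
    by exists l.
  have [l4 l4mu e4] : exists2 l, l < mu & (mu <= e i -> e j < e i ->
    bij mu (e i) l = e j).
    have [eimu|muei] := ltP (e i) mu; first by exists i => // /le_gtF;
      rewrite eimu.
    have [ji|ij] := ltP (e j) (e i); last by exists i.
    have [_ _ bs'] := hbij.1 mu (e i) hmu muei (hz _ ex).
    by have [l lmu el] := bs' (e j) ji; exists l.
  have [[_ Cunb _] _ _ _] := CfP _ ex.
  have [l5 C5 /andP[jl5 l5mu]] := Cunb j jmu.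
  have [m1 m1mu [l1m1 l2m1]] := ex_max l1mu l2mu.
  have [m2 m2mu [l3m2 l4m2]] := ex_max l3mu l4mu.
  have [m3 m3mu [m1m3 m2m3]] := ex_max m1mu m2mu.
  have [k kmu [m3k l5k]] := ex_max m3mu l5mu.
  have m1k := le_trans m1m3 m3k; have m2k := le_trans m2m3 m3k.
  exists k => //; split.
  - by exists l1 => //; exact: le_trans m1k.
  - by move=> /e2 le; apply: le_trans le _; exact: le_trans m1k.
  - by move=> /e3 el; exists l3 => //; exact: le_trans m2k.
  - by move=> eimu /(e4 eimu) el; exists l4 => //; exact: le_trans m2k.
  - by exists l5.
have Cclub := closure_club wo hmu lw wmu Rex.
exists [set a | [/\ a < mu, is_limit a, w < a &
    forall i j, i < a -> j < a -> exists2 k, k < a & R i j k]].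
have FE a z : F x a z <-> exists2 i, i < a & e i = z by rewrite canF_large.
(* Closure under [R] gives coherence at [a], as well as membership of [a] in the clubs of the levels
   in [F x a]. *)
have key a : a < mu -> is_limit a ->
    (forall i j, i < a -> j < a -> exists2 k, k < a & R i j k) ->
    [/\ seg a `<=` F x a, coherent_at bij mu x a Cf & forall z, F x a z ->
      Cf z a].
  move=> amu la Ra.
  have aF : seg a `<=` F x a.
    move=> i ia; have [k ka [[l lk el] _ _ _ _]] := Ra i i ia ia.
    by apply/FE; exists l => //; exact: le_lt_trans ka.
  have Fa z : F x a z -> z < mu -> z < a.
    move=> /FE[i ia <-] eimu;
      have [k ka [_ /(_ eimu) ek _ _ _]] := Ra i i ia ia.
    exact: le_lt_trans ka.
  have Flt z : F x a z -> z < x by apply: canF_lt => //; exact: ltW.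
  have Cu z : F x a z -> unbounded_in (Cf z) a.
    move=> /FE[i ia <-] y ya;
      have [k ka [_ _ _ _ [l lk [Cl yl]]]] := Ra i y ia ya.
    by exists l; rewrite ?yl //=; exact: le_lt_trans ka.
  split=> //; last first.
    by move=> z Fz; have [[_ _ Ccl] _ _ _] := CfP z (Flt z Fz);
      apply: Ccl => //; exact: Cu.
  split.
  - have [o o0] := ex_zero wo a; exists o => //; apply: aF.
    by have [t] := limit_nonempty la; exact: le_lt_trans.
  - move=> z Fz y; have [zmu|muz] := ltP z mu.
      rewrite canF_small //; split=> [yz|[]//].
      by split => //; apply: aF; exact: lt_trans (Fa z Fz zmu).
    split=> [Fy|[]].
      split; last by apply: canF_lt Fy => //; [exact: hz (Flt z Fz)|exact: ltW].
      move: Fz Fy muz => /FE[i ia <-]; move=> Fy muz; move: Fy;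
        rewrite canF_large // => -[j ja <-].
      have [k ka [_ _ /(_ muz)[l lk el] _ _]] := Ra i j ia ja.
      by apply/FE; exists l => //; exact: le_lt_trans ka.
    move: Fz muz => /FE[i ia <-] muz /FE[j ja <-] ji.
    have [k ka [_ _ _ /(_ muz ji)[l lk el] _]] := Ra i j ia ja.
    by rewrite canF_large //; exists l => //; exact: le_lt_trans ka.
  - by move=> z /Flt /CfP[].
  - exact: Cu.
  - by move=> z b /Flt /CfP[_ _ + _]; exact.
split => //; last first.
- by move=> xmu; move: mux; rewrite leNgt xmu.
- move=> a [amu la _ Ra] z Fz y; have [_ coh _] := key a amu la Ra.
  by move=> /(coh_F coh Fz)[].
move=> a [amu la wa Ra] S; have [aF coh Ca] := key a amu la Ra.
have Flt z : F x a z -> z < x by apply: canF_lt => //; exact: ltW.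
have [ra|nra] := EM (regular a); last first.
  have ax : a <= f mu x a.
    by apply: (order_type_le wo aF (order_type_seg a));
      exact: (canfP wo hbij hmu hx (ltW amu)).
  split=> [LS|/(s_stationary_singular_lt nra)]; last by rewrite ltNge ax.
  exfalso; move: nra => /not_andP[//|/existsNP[i /not_implyP[ia /existsNP[g
    /not_implyP[gi ng]]]]].
  (* [cofinal_not_dlim] needs a level strictly above the length [i]; taking [i'] below [a] keeps
     [seg i'] inside [F x a]. *)
  have [i' ii' i'a] := limit_between la ia; have i'mu := lt_trans i'a amu.
  have LS' : dlim i' S a.
    apply: (dlim_subset hbij hmu hx _ _ LS);
      first exact: lt_lt_card_succ (ltW i'mu).
    by rewrite canF_small // => t ti'; apply: aF; exact: lt_trans i'a.
  apply: (cofinal_not_dlim hbij hmu ii' i'mu gi _ LS') => s sa.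
  apply: contrapT => ns; apply: ng; exists s => // y yi.
  by rewrite leNgt; apply/negP => sg; apply: ns; exists y.
have fx : lt_card_succ (f mu x a) a.
  by apply: canf_lt_card_succ => // xmu; move: mux; rewrite leNgt xmu.
rewrite s_stationary_regular //; last first.
  have [o _ Fo] := coh_zero coh.
  move=> /(_ (f mu o a)); rewrite leNgt.
  by rewrite (coherent_canf_lt wo hbij hmu hx (ltW amu) (coh_F coh) Fo).
apply: (dlim_pair_clause hbij hmu hx amu la coh Ca).
- by move=> z /Flt /CfP[_ + _ _]; exact.
(* A level below [mu] lies below [a] by closure, and its canonical functions are constant above it;
   a level from [mu] on needs the club inside [a]. *)
- move=> z Fz; have [zmu|muz] := ltP z mu.
    have za : z < a.
      move: Fz zmu => /FE[i ia <-] eimu;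
        have [k ka [_ /(_ eimu) ek _ _ _]] := Ra i i ia ia.
      exact: le_lt_trans ka.
    exists [set b | z < b]; apply: reflects_on_tail => //.
      by have [_ _ _] := CfP z (Flt z Fz); exact.
    by move=> b; exact: canf_small.
  apply: (reflects_on_club ra lw wa amu muz (hz z (Flt z Fz))).
  + move=> t ta; apply/(coh_F coh Fz); split; first exact: aF.
    by apply: lt_le_trans muz; exact: lt_trans amu.
  + exact: (coh_club coh Fz).
  + exact: (coh_unbounded coh Fz).
Qed.

Lemma correct_club_exists w x : is_limit w -> w < mu -> lt_card_succ x mu ->
  exists C, correct_club x C.
Proof.
move=> lw wmu; elim/(wo_ind wo): x => x IH hx.
have [Cf CfP] : {Cf : O -> set O & forall z, z < x -> correct_club z (Cf z)}.
  apply: (@choice _ _ (fun z C => z < x -> correct_club z C)) => z.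
  have [zx|] := EM (z < x); last by exists set0.
  by have [C CP] := IH z zx (lt_card_succ_lt zx hx); exists C.
have [xmu|mux] := ltP x mu; last exact: (correct_club_large lw wmu mux hx CfP).
by exists [set a | x < a < mu]; exact: (correct_club_small hbij hmu xmu CfP).
Qed.

(** Below [mu] this is the usual characterization in a generated topology. From [mu] on, [[set a]]
    is open exactly when [a] is not in [dop] of its complement. *)
Lemma not_isolatedE x (a : below mu) :
  ~ isolated [set: tau_space wo bij mu x] a <-> dlim x setT (val a).
Proof.
have -> : dlim x setT (val a) = dop wo bij x [set: below mu] a.
  by rewrite propeqE; split=> [[t /val_inj -> ]//|da]; exists a.
rewrite (@isolated_setT (tau_space wo bij mu x)) tau_spaceE /tau_open.
have [xmu|mux] := ltP x mu.
  rewrite dopE /dop_step xmu; apply: iff_sym.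
  exact: (@limit_point_setT (gen_space (base wo x)) a).
(* Removing [a] from a set does not affect whether [a] is a limit point of it. *)
rewrite -(_ : dop wo bij x (~` [set a]) a = dop wo bij x setT a); last first.
  rewrite propeqE !dop_local; split=> H U nU; have [y [ya Ay Uy]] := H U nU;
    exists y => //.
  by split => //; apply/eqP.
split=> [nsub|da /(_ a da) /(_ erefl)//].
apply: contrapT => nda; apply: nsub => y dy /= ya; apply: nda.
by rewrite -{2}ya.
Qed.

End Large.

Theorem theorem6p16 (d : Order.disp_t) (O : orderType d)
    (wo : wochoice.well_order (<=%O : rel O))
    (bij : O -> O -> O -> O) (hbij : fixed_bijections bij)
    (mu : O) (hmu : regular mu) (x : O) (hx : lt_card_succ x mu) :
  exists C : set O, club C mu /\
    forall a : below mu, C (val a) -> regular (val a) ->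
      (~ isolated [set: tau_space wo bij mu x] a <->
       s_reflecting wo bij (canf bij mu x (val a)) (val a)).
Proof.
(* If [mu] is the least limit ordinal, no point below it is regular and the whole of [mu] serves as
   the club. *)
have [[w wmu lw]|nw] := EM (exists2 w, w < mu & is_limit w); last first.
  exists (seg mu); split.
    split=> // y ymu; exists y; rewrite ?lexx //.
  by move=> a amu [la _]; exfalso; apply: nw; exists (val a).
have [C [Cclub CL _ _]] := correct_club_exists wo hbij hmu lw wmu hx.
exists C; split => // a Ca _; rewrite not_isolatedE;
  apply: iff_trans (CL _ Ca _).
(* [s_reflecting] refers to [seg (val a)] in place of [setT]; limits depend only on the points below
   [val a]. *)
split=> [La|]; last exact: (subset_dlim hbij hmu hx).
have [amu nP] := (dlimP wo hbij hmu _ _ hx).1 La.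
apply/(dlimP wo hbij hmu _ _ hx); split => // U /nP[y ya [_ Uy]].
by exists y.
Qed.
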